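(* Let $(X,x)\subset(\mathbb{C}^n,x)$, $(Y,y)\subset(\mathbb{C}^m,y)$ and $(Z,z)\subset(\mathbb{C}^l,z)$ be germs of complex analytic spaces, with morphisms $\alpha:(Z,z)\to(X,x)$ and $\beta:(Z,z)\to(Y,y)$ whose induced homomorphisms $\alpha_z^*:\mathcal{O}_{X,x}\to\mathcal{O}_{Z,z}$ and $\beta_z^*:\mathcal{O}_{Y,y}\to\mathcal{O}_{Z,z}$ are surjective and not isomorphisms. Let $(\mathcal{V},v)=(X,x)\sqcup_{(Z,z)}(Y,y)$. (i) If the gluing $(\mathcal{V},v)$ is weakly large, then $$P^{(\mathcal{V},v)}_{(X,x)}(t)=\frac{1-P^{(\mathcal{V},v)}_{(Y,y)}(t)}{1-P^{(X,x)}_{(Z,z)}(t)}.$$ (ii) If the gluing $(\mathcal{V},v)$ is large and $(W,w)$ is a subspace of $(X,x)$, then $$P^{(\mathcal{V},v)}_{(W,w)}(t)=\frac{P^{(X,x)}_{(W,w)}(t)\left(1-P^{(\mathcal{V},v)}_{(Y,y)}(t)\right)}{1-P^{(X,x)}_{(Z,z)}(t)}.$$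
   Context: Germs: for a germ $(X,x)\subset(\mathbb{C}^n,x)$ of a complex analytic space, $\mathcal{O}_{X,x}\cong\mathcal{O}_{\mathbb{C}^n,x}/\mathcal{I}_{X,x}$ where $\mathcal{I}_{X,x}$ is the ideal of all germs of holomorphic functions vanishing on $X$; it is a reduced Noetherian local analytic $\mathbb{C}$-algebra with residue field $\mathbb{C}$. A subspace $(W,w)$ of $(X,x)$ is one defined by a reduced (i.e. radical) ideal $I\subset\mathcal{O}_{X,x}$, with local ring $\mathcal{O}_{X,x}/I$. Poincaré series: for a finitely generated $\mathcal{O}_{X,x}$-module $M$, $P^{\mathcal{O}_{X,x}}_M(t)=\sum_{i\ge0}\beta_i^{\mathcal{O}_{X,x}}(M)t^i$, where $\beta_i^{\mathcal{O}_{X,x}}(M)=\dim_{\mathbb{C}}\mathrm{Tor}_i^{\mathcal{O}_{X,x}}(M,\mathbb{C})$. For a subspace $(W,w)$ defined by $I$, $P^{(X,x)}_{(W,w)}(t):=P^{\mathcal{O}_{X,x}}_{\mathcal{O}_{X,x}/I}(t)$. Quotients of power series are read as formal Laurent series. Gluing: $(\mathcal{V},v)=(X,x)\sqcup_{(Z,z)}(Y,y)$ is the pushout of $\alpha:(Z,z)\to(X,x)$ and $\beta:(Z,z)\to(Y,y)$, with canonical morphisms $f:(X,x)\to(\mathcal{V},v)$ and $g:(Y,y)\to(\mathcal{V},v)$. Its local ring is the fiber product $\mathcal{O}_{\mathcal{V},v}=\{(s,t)\in\mathcal{O}_{X,x}\times\mathcal{O}_{Y,y}:\alpha_z^*(s)=\beta_z^*(t)\}$,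 a Noetherian local analytic $\mathbb{C}$-algebra, and $f,g$ correspond to the surjective projections $\pi_1:\mathcal{O}_{\mathcal{V},v}\to\mathcal{O}_{X,x}$ and $\pi_2:\mathcal{O}_{\mathcal{V},v}\to\mathcal{O}_{Y,y}$. Through $\pi_1$ (resp. $\pi_2$), $\mathcal{O}_{X,x}$-modules (resp. $\mathcal{O}_{Y,y}$-modules) are $\mathcal{O}_{\mathcal{V},v}$-modules, and subspaces of $(X,x)$ (resp. $(Y,y)$) are regarded as subspaces of $(\mathcal{V},v)$. Large morphism: a morphism $h:(Y',y')\to(X',x')$ of germs with $\mathcal{O}_{X',x'}\to\mathcal{O}_{Y',y'}$ surjective is large if for every subspace $(W,w)$ of $(Y',y')$, regarded as a subspace of $(X',x')$, one has $P^{(X',x')}_{(W,w)}=P^{(Y',y')}_{(W,w)}P^{(X',x')}_{(Y',y')}$. Weakly large gluing: $P^{\mathcal{O}_{\mathcal{V},v}}_{K}(t)=P^{\mathcal{O}_{X,x}}_{K}(t)\,P^{(\mathcal{V},v)}_{(X,x)}(t)$, where $K=\ker(\alpha_z^* )$ is viewed as an $\mathcal{O}_{X,x}$-module. Large gluing: the morphism $f$ is large. *)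

(* Defs.v *)
From HB Require Import structures.
From mathcomp Require Import all_boot all_order all_algebra.
From mathcomp Require Import generic_quotient ring_quotient complex.
From mathcomp Require Import all_classical all_reals topology normedtype sequences.

Set Implicit Arguments.
Unset Strict Implicit.
Unset Printing Implicit Defensive.

Import Order.TTheory GRing.Theory Num.Theory.
Import numFieldNormedType.Exports.

Local Open Scope ring_scope.
Local Open Scope quotient_scope.

Definition fps (F : fieldType) : Type := nat -> F.

Section FormalPowerSeries.
Variable F : fieldType.
Implicit Types a b c : fps F.

HB.instance Definition _ := GRing.Zmodule.copy (fps F) (nat -> F).

Definition fps_one : fps F := fun n => (n == 0)%:R.
Definition fps_mul a b : fps F := fun n => \sum_(j < n.+1) a j * b (n - j)%N.

Local Definition trunc N a : {poly F} := \poly_(i < N) a i.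

Local Lemma fps_mulE N a b n :
  (n < N)%N -> fps_mul a b n = (trunc N a * trunc N b)`_n.
Proof.
move=> ltnN; rewrite coefM; apply: eq_bigr => j _; rewrite !coef_poly.
by rewrite !ifT //; [exact: leq_ltn_trans (leq_subr _ _) ltnN |
  exact: leq_ltn_trans (leq_ord _) ltnN].
Qed.

Local Lemma coef_truncM N a (p q : {poly F}) n : (n < N)%N ->
  (forall k, (k <= n)%N -> p`_k = q`_k) ->
  (trunc N a * p)`_n = (trunc N a * q)`_n.
Proof.
by move=> ltnN pq; rewrite !coefM; apply: eq_bigr => j _; rewrite pq ?leq_subr.
Qed.

Local Lemma fps_mulC : commutative fps_mul.
Proof.
by move=> a b; apply/funext => n; rewrite !(@fps_mulE n.+1) // mulrC.
Qed.

Local Lemma fps_mulA : associative fps_mul.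
Proof.
move=> a b c; apply/funext => n; rewrite [RHS](congr1 (@^~ n) (fps_mulC _ _)).
rewrite !(@fps_mulE n.+1) //.
have E d e k : (k <= n)%N ->
    (trunc n.+1 (fps_mul d e))`_k = (trunc n.+1 d * trunc n.+1 e)`_k.
  by move=> lekn; rewrite coef_poly ltnS lekn (@fps_mulE n.+1).
rewrite (coef_truncM _ _ (E b c)) // (coef_truncM _ _ (E a b)) //.
by rewrite mulrA mulrC.
Qed.

Local Lemma fps_mul1 : left_id fps_one fps_mul.
Proof.
move=> a; apply/funext => n; rewrite /fps_mul big_ord_recl subn0 mul1r.
by rewrite big1 ?addr0 // => j _; rewrite mul0r.
Qed.

Local Lemma fps_mulDl : left_distributive fps_mul +%R.
Proof.
move=> a b c; apply/funext => n.
transitivity (\sum_(j < n.+1) (a j + b j) * c (n - j)%N) => //.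
by rewrite (eq_bigr _ (fun j _ => mulrDl _ _ _)) big_split.
Qed.

Local Lemma fps_one_neq0 : fps_one != 0.
Proof. by apply/eqP => /(congr1 (@^~ 0%N))/eqP; rewrite oner_eq0. Qed.

HB.instance Definition _ := GRing.Zmodule_isComNzRing.Build (fps F)
  fps_mulA fps_mulC fps_mul1 fps_mulDl fps_one_neq0.

Definition fps_unit : {pred fps F} := [pred a | `[< exists b, b * a = 1 >]].
Definition fps_inv a : fps F :=
  if pselect (exists b, b * a = 1) is left h then sval (cid h) else a.

Local Lemma fps_mulVx : {in fps_unit, left_inverse 1 fps_inv *%R}.
Proof.
move=> a /asboolP ua; rewrite /fps_inv; case: pselect => // h.
exact: svalP (cid h).
Qed.

Local Lemma fps_unitPl a b : b * a = 1 -> fps_unit a.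
Proof. by move=> ba; apply/asboolP; exists b. Qed.

Local Lemma fps_inv_out : {in [predC fps_unit], fps_inv =1 id}.
Proof.
by move=> a /asboolPn ua; rewrite /fps_inv; case: pselect => // /ua.
Qed.

HB.instance Definition _ := GRing.ComNzRing_hasMulInverse.Build (fps F)
  fps_mulVx fps_unitPl fps_inv_out.

Local Lemma fps_order a : a != 0 ->
  {i | a i != 0 & forall j, (j < i)%N -> a j = 0}.
Proof.
move=> /eqP a0; have exa : exists i, a i != 0.
  apply: contrapT => /forallNP a_0; apply: a0; apply/funext => i.
  by apply/eqP; apply/negP => /negP/a_0.
case: (ex_minnP exa) => i ai0 mini; exists i => // j ltji.
by apply/eqP; apply: contraTT ltji; rewrite -leqNgt => /mini.
Qed.

Local Lemma fps_integral : GRing.integral_domain_axiom (fps F).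
Proof.
move=> a b ab0; apply/norP => -[/fps_order[i ai0 mini] /fps_order[j bj0 minj]].
suff /eqP : (a * b) (i + j)%N = a i * b j.
  by rewrite ab0 eq_sym mulf_eq0 (negPf ai0) (negPf bj0).
have lti : (i < (i + j).+1)%N by rewrite ltnS leq_addr.
rewrite [LHS](bigD1 (Ordinal lti)) //= addKn big1 ?addr0 // => k.
rewrite -val_eqE /= => ki; have [/mini->|leik] := ltnP k i; first by rewrite mul0r.
rewrite minj ?mulr0 // ltn_subLR; last by rewrite -ltnS.
by rewrite ltn_add2r ltn_neqAle eq_sym ki.
Qed.

HB.instance Definition _ := GRing.ComUnitRing_isIntegral.Build (fps F)
  fps_integral.

End FormalPowerSeries.

(* F((t)) is the fraction field of F[[t]]. *)
Notation laurent F := {fraction (fps F)}.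
Notation "p %:L" := (tofrac p) (at level 2, format "p %:L") : ring_scope.

(* M, an S-module, viewed as an R-module through phi.                         *)
Definition restr (R S : pzRingType) (phi : {rmorphism R -> S}) (M : Type) :=
  M.

Section Restriction.
Variables (R S : pzRingType) (phi : {rmorphism R -> S}) (M : lmodType S).
Local Notation restrM := (restr phi M).

HB.instance Definition _ := GRing.Zmodule.on restrM.

Definition restr_scale (a : R) (v : restrM) : restrM := phi a *: (v : M).

Local Lemma restr_scaleA a b v :
  restr_scale a (restr_scale b v) = restr_scale (a * b) v.
Proof. by rewrite /restr_scale scalerA rmorphM. Qed.
Local Lemma restr_scale1 : left_id 1 restr_scale.
Proof. by move=> v; rewrite /restr_scale rmorph1 scale1r. Qed.
Local Lemma restr_scaleDr : right_distributive restr_scale +%R.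
Proof. by move=> a u v; rewrite /restr_scale scalerDr. Qed.
Local Lemma restr_scaleDl v : {morph restr_scale^~ v : a b / a + b}.
Proof. by move=> a b; rewrite /restr_scale rmorphD scalerDl. Qed.

HB.instance Definition _ := GRing.Zmodule_isLmodule.Build R restrM
  restr_scaleA restr_scale1 restr_scaleDr restr_scaleDl.

End Restriction.

Section Kernel.
Variables (R S : comNzRingType) (phi : {rmorphism R -> S}).

Definition in_ker : {pred R^o} := [pred a | phi a == 0].

Local Lemma in_ker_closed : submod_closed in_ker.
Proof.
split=> [|a u v]; rewrite !inE ?rmorph0 // => /eqP u0 /eqP v0.
by rewrite rmorphD rmorphM u0 v0 mulr0 addr0.
Qed.

HB.instance Definition _ := GRing.isSubmodClosed.Build R R^o in_ker
  in_ker_closed.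

(* The ideal ker phi as an R-module.                                          *)
Record ker_mod := KerMod { ker_val :> R^o; _ : ker_val \in in_ker }.
HB.instance Definition _ := [isSub for ker_val].
HB.instance Definition _ := [Choice of ker_mod by <:].
HB.instance Definition _ := [SubChoice_isSubLmodule of ker_mod by <:].

End Kernel.

Section FiberProduct.
Variables (A B D : comNzRingType).
Variables (phi : {rmorphism A -> D}) (psi : {rmorphism B -> D}).

Definition in_fiber_prod : {pred A * B} := [pred u | phi u.1 == psi u.2].

Local Lemma in_fiber_prod_closed : subring_closed in_fiber_prod.
Proof.
split; first by rewrite inE !rmorph1.
  by move=> u v; rewrite !inE !rmorphB => /eqP-> /eqP->.
by move=> u v; rewrite !inE !rmorphM => /eqP-> /eqP->.
Qed.

HB.instance Definition _ := GRing.isSubringClosed.Build (A * B)%type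
  in_fiber_prod in_fiber_prod_closed.

Record fiber_prod :=
  FiberProd { fiber_val :> A * B; _ : fiber_val \in in_fiber_prod }.
HB.instance Definition _ := [isSub for fiber_val].
HB.instance Definition _ := [Choice of fiber_prod by <:].
HB.instance Definition _ := [SubChoice_isSubComNzRing of fiber_prod by <:].

Definition fiber_fst (u : fiber_prod) : A := (val u).1.
Definition fiber_snd (u : fiber_prod) : B := (val u).2.

Local Lemma fiber_fst_zmod : zmod_morphism fiber_fst.
Proof. by []. Qed.
Local Lemma fiber_fst_monoid : monoid_morphism fiber_fst.
Proof. by []. Qed.
HB.instance Definition _ := GRing.isZmodMorphism.Build fiber_prod A fiber_fst
  fiber_fst_zmod.
HB.instance Definition _ := GRing.isMonoidMorphism.Build fiber_prod A fiber_fst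
  fiber_fst_monoid.

Local Lemma fiber_snd_zmod : zmod_morphism fiber_snd.
Proof. by []. Qed.
Local Lemma fiber_snd_monoid : monoid_morphism fiber_snd.
Proof. by []. Qed.
HB.instance Definition _ := GRing.isZmodMorphism.Build fiber_prod B fiber_snd
  fiber_snd_zmod.
HB.instance Definition _ := GRing.isMonoidMorphism.Build fiber_prod B fiber_snd
  fiber_snd_monoid.

End FiberProduct.

HB.mixin Record isRadical (R : nzRingType) (S : R -> bool) := {
  radical_subproof : forall a n, a ^+ n \in S -> a \in S
}.

#[short(type="radical_idealr")]
HB.structure Definition RadicalIdealr (R : nzRingType) :=
  {S of Idealr R S & isRadical R S}.

(* R / I as an R-module; an idealr is proper, so the subspace cut out by I    *)
(* contains the base point.                                                   *)
Definition quot_mod (R : comNzRingType) (I : radical_idealr R) : lmodType R :=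
  restr (\pi_{ideal_quot I} : {rmorphism _ -> _}) ({ideal_quot I}^o).

Record free_resolution (R : comNzRingType) (M : lmodType R) :=
  FreeResolution {
    frank : nat -> nat;
    faug : {linear 'rV[R]_(frank 0) -> M};
    fdiff : forall i, 'M[R]_(frank i.+1, frank i);
    faug_surj : forall v, exists u, faug u = v;
    fexact0 : forall u, faug u = 0 <-> exists w, u = w *m fdiff 0;
    fexactS : forall i (u : 'rV[R]_(frank i.+1)),
      u *m fdiff i = 0 <-> exists w, u = w *m fdiff i.+1
  }.

Section PoincareSeries.
Variables (R : comNzRingType) (k : fieldType) (eps : {rmorphism R -> k}).
Variable M : lmodType R.

(* Tor_i(M, k) is the homology in degree i of F (x)_R k, the complex of the   *)
(* spaces 'rV[k]_(frank F i) with the differentials map_mx eps (fdiff F i).   *)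
(* Its dimension is that of a kernel minus that of an image; the degree 0     *)
(* kernel is the whole space.                                                 *)
Definition tor_dim (F : free_resolution M) (i : nat) : nat :=
  (if i is j.+1 then \rank (kermx (map_mx eps (fdiff F j))) else frank F 0)
  - \rank (map_mx eps (fdiff F i)).

(* The dimension of Tor_i(M, k) for the residue map eps. It does not depend   *)
(* on the resolution, and finitely generated modules over Noetherian rings    *)
(* have resolutions by free modules of finite rank; the value is 0 when there *)
(* is no such resolution.                                                     *)
Definition betti (i : nat) : nat :=
  xget 0%N [set d | exists F : free_resolution M, d = tor_dim F i].

Definition poincare : fps rat := fun i => (betti i)%:R.

End PoincareSeries.

Section Large.
Variables (R S : comNzRingType) (k : fieldType).
Variables (epsR : {rmorphism R -> k}) (epsS : {rmorphism S -> k}).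

(* For a surjective phi, the comorphism of a morphism of germs, and the       *)
(* subspaces W of its source given by radical ideals of S.                    *)
Definition large (phi : {rmorphism R -> S}) : Prop :=
  forall I : radical_idealr S,
    poincare epsR (restr phi (quot_mod I)) =
    poincare epsS (quot_mod I) * poincare epsR (restr phi S^o).

End Large.
Local Open Scope classical_set_scope.

(* As a numClosedFieldType, R[i] has the topology of its norm. The definition *)
(* is locked because unification otherwise unfolds it and diverges on         *)
(* topological goals.                                                         *)
HB.lock Definition Cplx (R : realType) : numClosedFieldType := R[i]%C.

Lemma Cplx_real (R : realType) : exists iota : {rmorphism R -> Cplx R},
  [/\ {mono iota : a b / a <= b}, {mono iota : a b / a < b} &
      forall z, 0 <= z -> exists a, z = iota a].
Proof.
rewrite Cplx.unlock; exists (@real_complex R); split=> [a b|a b|[a b]].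
- exact: lecR.
- exact: ltcR.
by rewrite lecE /= => /andP[/eqP-> _]; exists a.
Qed.

Local Lemma cvgM_dist (K : numFieldType) (f g h : nat -> K) (s t : K) :
  f N @[N --> \oo] --> s -> g N @[N --> \oo] --> t ->
  (forall e, 0 < e -> \forall N \near \oo, `|f N * g N - h N| < e) ->
  h N @[N --> \oo] --> s * t.
Proof.
move=> fs gt fgh.
have -> : h = (fun N => f N * g N - (f N * g N - h N)).
  by apply/funext => N; rewrite opprB addrC subrK.
by rewrite -[s * t]subr0; apply: cvgB; [exact: cvgM | exact/cvgr0Pnorm_lt].
Qed.

Section MultipleSeries.
Variables (R : realType) (n : nat).
Local Notation C := (Cplx R).
Local Notation mindex := {ffun 'I_n -> nat}.
Implicit Types (u v : mindex -> C) (k l m : mindex) (N : nat).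

(* The partial sum over the multi-indices m with m i < N for all i.           *)
Definition box_sum u N : C :=
  \sum_(m : {ffun 'I_n -> 'I_N}) u [ffun i => m i : nat].

(* The multiple series of the u m converges absolutely, with sum s.           *)
Definition abs_sum u (s : C) : Prop :=
  (exists M, forall N, box_sum (fun m => `|u m|) N <= M) /\
  box_sum u N @[N --> \oo] --> s.

Local Definition box N : seq mindex :=
  [seq [ffun i => m i : nat] | m : {ffun 'I_n -> 'I_N}].
Local Definition lem k m := [forall i, (k i <= m i)%N].
Local Definition addm k l : mindex := [ffun i => (k i + l i)%N].
Local Definition subm m k : mindex := [ffun i => (m i - k i)%N].
Local Definition conv u v m : C :=
  \sum_(k <- box (\sum_i m i)%N.+1 | lem k m) u k * v (subm m k).

Lemma box_sumE u N : box_sum u N = \sum_(m <- box N) u m.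
Proof. by rewrite big_image. Qed.

Lemma mem_box N m : (m \in box N) = [forall i, (m i < N)%N].
Proof.
apply/fintype.imageP/forallP => [[f _ ->] i|mN]; first by rewrite ffunE.
exists [ffun i => Ordinal (mN i)] => //; apply/ffunP => i.
by rewrite !ffunE.
Qed.

Lemma box_uniq N : uniq (box N).
Proof.
rewrite map_inj_uniq ?enum_uniq // => f g fg; apply/ffunP => i.
by apply/val_inj; have /ffunP/(_ i) := fg; rewrite !ffunE.
Qed.

Lemma box_narrow u (P : pred mindex) N N' : (N' <= N)%N ->
  \sum_(m <- box N' | P m) u m = \sum_(m <- box N | P m && (m \in box N')) u m.
Proof.
move=> leN; rewrite -big_filter -[RHS]big_filter; apply: perm_big.
apply: uniq_perm; rewrite ?filter_uniq ?box_uniq // => m.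
rewrite !mem_filter; case: (P m) => //=; have [|_] := boolP (m \in box N') => //.
rewrite !mem_box => /forallP mN; apply/esym/forallP => i.
exact: leq_trans (mN i) leN.
Qed.

Local Lemma convE u v N m : m \in box N ->
  conv u v m = \sum_(k <- box N | lem k m) u k * v (subm m k).
Proof.
rewrite mem_box => /forallP mN; rewrite /conv -[LHS]big_filter -[RHS]big_filter.
apply: perm_big; apply: uniq_perm; rewrite ?filter_uniq ?box_uniq // => k.
rewrite !mem_filter; have [/forallP km|//] := boolP (lem k m) => /=.
rewrite !mem_box; transitivity true.
  apply/forallP => i; rewrite ltnS (leq_trans (km i)) // (bigD1 i) //=.
  exact: leq_addr.
by apply/esym/forallP => i; apply: leq_ltn_trans (km i) (mN i).
Qed.

Local Lemma box_sum_conv u v N : box_sum (conv u v) N =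
  \sum_(k <- box N) \sum_(l <- box N | addm k l \in box N) u k * v l.
Proof.
rewrite box_sumE big_seq (eq_bigr _ (fun m mN => convE u v mN)) -big_seq.
rewrite (exchange_big_dep predT) //=; apply: eq_bigr => k _.
rewrite -big_filter -[RHS]big_filter.
transitivity (\sum_(l <- [seq l <- box N | addm k l \in box N])
    u k * v (subm (addm k l) k)); last first.
  by apply: eq_bigr => l _; congr (_ * v _); apply/ffunP => i; rewrite !ffunE addKn.
rewrite -(big_map (addm k) predT (fun m => u k * v (subm m k))).
apply: perm_big; apply: uniq_perm.
- by rewrite filter_uniq ?box_uniq.
- rewrite map_inj_uniq ?filter_uniq ?box_uniq // => l l' /ffunP e.
  by apply/ffunP => i; have := e i; rewrite !ffunE => /addnI.
move=> m; rewrite mem_filter; apply/andP/mapP => [[/forallP km mN]|[l + ->]].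
  exists (subm m k); last by apply/ffunP => i; rewrite !ffunE subnKC.
  rewrite mem_filter.
  have -> : addm k (subm m k) = m by apply/ffunP => i; rewrite !ffunE subnKC.
  rewrite mN mem_box; apply/forallP => i; rewrite ffunE.
  by rewrite mem_box in mN; apply: leq_ltn_trans (forallP mN i); apply: leq_subr.
rewrite mem_filter => /andP[klN _]; split => //; apply/forallP => i.
by rewrite ffunE leq_addr.
Qed.

Local Notation A u := (box_sum (fun m => `|u m|)).

Local Lemma A_ge0 u N : 0 <= A u N.
Proof. exact: sumr_ge0. Qed.

Local Lemma A_homo u N N' : (N' <= N)%N -> A u N' <= A u N.
Proof.
move=> leN; rewrite !box_sumE (box_narrow _ _ leN) /= big_mkcond /=.
by apply: ler_sum => m _; case: ifP.
Qed.

Local Lemma conv_dist u v N : `|box_sum u N * box_sum v N - box_sum (conv u v) N|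
  <= A u N * A v N - A u N./2 * A v N./2.
Proof.
have leh : (N./2 <= N)%N by rewrite -leq_double -[leqRHS]addnn (leq_trans _ (leq_addr _ _)) // -[leqRHS]odd_double_half leq_addl.
rewrite box_sum_conv !box_sumE !(box_narrow _ _ leh) /=.
rewrite !big_distrl /= -sumrB.
rewrite [X in _ <= _ - X]big_mkcond /= -sumrB.
apply: le_trans (ler_norm_sum _ _ _) _; apply: ler_sum => k _.
have -> : (if k \in box N./2 then
    `|u k| * \sum_(i <- box N | i \in box N./2) `|v i| else 0) =
  \sum_(l <- box N) (if (k \in box N./2) && (l \in box N./2)
    then `|u k| * `|v l| else 0).
  by case: ifP => _ /=; [rewrite big_distrr big_mkcond | rewrite big1].
rewrite !big_distrr /= [X in `|_ - X|]big_mkcond /= -sumrB.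
apply: le_trans (ler_norm_sum _ _ _) _.
rewrite -sumrB; apply: ler_sum => l _.
case: ifP => [_|kl]; first rewrite subrr normr0.
  by case: ifP => _; rewrite ?subrr // subr0 mulr_ge0.
rewrite subr0 normrM; case: ifP => [/andP[kN lN]|_]; last by rewrite subr0.
exfalso; move/negP: kl; apply; rewrite mem_box; apply/forallP => i.
rewrite ffunE; move: kN lN; rewrite !mem_box => /forallP/(_ i) k2 /forallP/(_ i) l2.
have : (k i + l i < N./2 + N./2)%N by rewrite -addSn leq_add // ltnW.
move=> /leq_trans; apply; rewrite addnn -[leqRHS]odd_double_half.
exact: leq_addl.
Qed.

Lemma abs_sumM u v s t :
  abs_sum u s -> abs_sum v t -> abs_sum (conv u v) (s * t).
Proof.
move=> [[Mu Au] us] [[Mv Av] vt]; split.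
  exists (Mu * Mv) => N; apply: (@le_trans _ _ (A u N * A v N)).
    have -> : A u N * A v N = \sum_(k <- box N) \sum_(l <- box N) `|u k| * `|v l|.
      by rewrite !box_sumE big_distrl; apply: eq_bigr => k _; rewrite big_distrr.
    apply: (@le_trans _ _ (box_sum (conv (Num.norm \o u) (Num.norm \o v)) N)).
      apply: ler_sum => m _; apply: le_trans (ler_norm_sum _ _ _) _.
      by apply: ler_sum => k _; rewrite normrM.
    rewrite box_sum_conv; apply: ler_sum => k _; rewrite big_mkcond /=.
    by apply: ler_sum => l _; case: ifP => // _; rewrite mulr_ge0.
  by rewrite ler_pM ?A_ge0.
have [iota [iota_le iota_lt iotaP]] := Cplx_real R.
have /choice[p pE] : forall N, exists a, A u N * A v N = iota a.
  by move=> N; apply: iotaP; rewrite mulr_ge0 ?A_ge0.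
have p_homo : {homo p : N N' / (N <= N')%N >-> N <= N'}.
  move=> N N' leN; rewrite -iota_le -!pE.
  by rewrite ler_pM ?A_ge0 ?A_homo.
have p_cvg : cvgn p.
  have Muv N : A u N * A v N <= Mu * Mv by rewrite ler_pM ?A_ge0.
  have [|B BE] := iotaP (Mu * Mv).
    by apply: le_trans (Muv 0%N); rewrite mulr_ge0 ?A_ge0.
  apply: nondecreasing_is_cvgn => //; exists B => _ [N _ <-].
  by rewrite -iota_le -pE -BE.
have half_cvg : p N./2 @[N --> \oo] --> limn p.
  apply: (@cvg_comp _ _ _ half p \oo \oo) p_cvg.
  move=> P [N _ NP]; exists N.*2 => // k /= leNk; apply: NP => /=.
  by rewrite geq_half_double in leNk *.
have dcvg : p N - p N./2 @[N --> \oo] --> 0.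
  by rewrite -(subrr (limn p)); apply: cvgB.
apply: (cvgM_dist us vt) => e e0.
have [e' eE] := iotaP _ (ltW e0).
have e'0 : 0 < e' by rewrite -iota_lt rmorph0 -eE.
move/cvgr0Pnorm_lt: dcvg => /(_ _ e'0); apply: filterS => N pN.
apply: le_lt_trans (conv_dist u v N) _; rewrite !pE eE -rmorphB iota_lt.
exact: le_lt_trans (ler_norm _) pN.
Qed.

Lemma abs_sumB u v s t : abs_sum u s -> abs_sum v t ->
  abs_sum (fun m => u m - v m) (s - t).
Proof.
move=> [[Mu Au] us] [[Mv Av] vt]; split.
  exists (Mu + Mv) => N; apply: le_trans (lerD (Au N) (Av N)).
  by rewrite -big_split; apply: ler_sum => m _; apply: ler_normB.
rewrite (_ : box_sum _ = (fun N => box_sum u N - box_sum v N)).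
  exact: cvgB.
by apply/funext => N; rewrite /box_sum sumrB.
Qed.

Lemma abs_sum1 u :
  (forall m, u m = [forall i, m i == 0%N]%:R) -> abs_sum u 1.
Proof.
move=> uE; pose z : mindex := [ffun=> 0%N].
have uz m : u m = (m == z)%:R.
  rewrite uE; congr (nat_of_bool _)%:R; apply/forallP/eqP => [m0|-> i].
    by apply/ffunP => i; rewrite ffunE; apply/eqP.
  by rewrite ffunE.
have sumE N : box_sum u N = (z \in box N)%:R.
  rewrite box_sumE; have [zN|zN] := boolP (z \in box N).
    rewrite (bigD1_seq z) ?box_uniq //= uz eqxx big1 ?addr0 // => m /negPf mz.
    by rewrite uz mz.
  rewrite big_seq big1 // => m mN; rewrite uz.
  by have [mz|//] := eqVneq m z; rewrite mz (negPf zN) in mN.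
split.
  exists 1 => N; have -> : box_sum (fun m => `|u m|) N = box_sum u N.
    by apply: eq_bigr => m _; rewrite uz normr_nat.
  by rewrite sumE lern1 leq_b1.
apply: cvg_near_cst; exists 1%N => // N /= N0; rewrite sumE mem_box.
by rewrite (_ : [forall i, _]) //; apply/forallP => i; rewrite ffunE.
Qed.

End MultipleSeries.

Section Holomorphic.
Variables (R : realType) (n : nat) (x : 'rV[Cplx R]_n).
Local Notation C := (Cplx R).
Implicit Types f g : 'rV[C]_n -> C.

Definition monom (w : 'rV[C]_n) (m : {ffun 'I_n -> nat}) : C :=
  \prod_i w 0 i ^+ m i.

(* f is the sum of an absolutely convergent power series in z - x for all z   *)
(* in a neighbourhood of x.                                                   *)
Definition holomorphic_at f : Prop :=
  exists c : {ffun 'I_n -> nat} -> C, \forall z \near x,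
    abs_sum (fun m => c m * monom (z - x) m) (f z).

Definition in_holo : {pred 'rV[C]_n -> C} := [pred f | `[< holomorphic_at f >]].

Local Lemma in_holo_closed : subring_closed in_holo.
Proof.
split.
- apply/asboolP; exists (fun m => [forall i, m i == 0%N]%:R).
  apply: filterE => z; apply: abs_sum1 => m.
  case: forallP => [m0|_]; last by rewrite mul0r.
  by rewrite /monom big1 ?mulr1 // => i _; rewrite (eqP (m0 i)) expr0.
- move=> f g /asboolP[c cf] /asboolP[d dg]; apply/asboolP.
  exists (fun m => c m - d m); near=> z.
  rewrite (_ : (fun m => _) = fun m =>
    c m * monom (z - x) m - d m * monom (z - x) m).
    by apply: abs_sumB; [near: z; exact: cf | near: z; exact: dg].
  by apply/funext => m; rewrite mulrBl.
move=> f g /asboolP[c cf] /asboolP[d dg]; apply/asboolP.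
exists (conv c d); near=> z.
rewrite (_ : (fun m => _) = conv
    (fun m => c m * monom (z - x) m)
    (fun m => d m * monom (z - x) m)).
  by apply: abs_sumM; [near: z; exact: cf | near: z; exact: dg].
apply/funext => m; rewrite /conv big_distrl /=; apply: eq_bigr => k /forallP km.
rewrite mulrACA /monom -big_split /=; congr (_ * _); apply: eq_bigr => i _.
by rewrite -exprD ffunE subnKC.
Unshelve. all: by end_near. Qed.

HB.instance Definition _ := GRing.isSubringClosed.Build ('rV[C]_n -> C)
  in_holo in_holo_closed.

(* Functions, not germs: the local rings below are quotients of [holo] that   *)
(* identify functions with the same germ.                                     *)
Record holo := Holo { hfun :> 'rV[C]_n -> C; _ : hfun \in in_holo }.
HB.instance Definition _ := [isSub for hfun].
HB.instance Definition _ := [Choice of holo by <:].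
HB.instance Definition _ := [SubChoice_isSubComNzRing of holo by <:].

End Holomorphic.

(* The reduced germ at gpt of the set gset, which near gpt is the zero set of *)
(* finitely many holomorphic functions.                                       *)
Record germ (R : realType) (n : nat) := Germ {
  gset : set 'rV[Cplx R]_n;
  gpt : 'rV[Cplx R]_n;
  gpt_in : gset gpt;
  gset_analytic : exists r (h : 'I_r -> holo gpt),
    \forall z \near gpt, gset z <-> forall i, h i z = 0
}.

Section LocalRing.
Variables (R : realType) (n : nat) (X : germ R n).

Definition vanishing : {pred holo (gpt X)} :=
  [pred f : holo (gpt X) | `[< \forall z \near gpt X, gset X z -> f z = 0 >]].

Local Lemma vanishing_closed : idealr_closed vanishing.
Proof.
split.
- by apply/asboolP; apply: filterE.
- apply/asboolP => /nbhs_singleton /(_ (gpt_in X)) /eqP.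
  by rewrite oner_eq0.
move=> f g h /asboolP g0 /asboolP h0; apply/asboolP.
near=> z => Xz; transitivity (f z * g z + h z) => //.
have gz : g z = 0 by move: Xz; near: z.
have hz : h z = 0 by move: Xz; near: z.
by rewrite gz hz mulr0 addr0.
Unshelve. all: by end_near. Qed.

HB.instance Definition _ := isIdealr.Build (holo (gpt X)) vanishing
  vanishing_closed.

(* O_{X,x} = O_{C^n,x} / I_{X,x}                                              *)
Definition local_ring : comNzRingType := {ideal_quot vanishing}.

Definition germ_of (f : holo (gpt X)) : local_ring := \pi_{ideal_quot vanishing} f.

(* The residue map O_{X,x} -> C, evaluation at the base point.                *)
Definition residue (a : local_ring) : Cplx R := (repr a : holo (gpt X)) (gpt X).

Lemma germ_ofP (f g : holo (gpt X)) :
  reflect (\forall z \near gpt X, gset X z -> f z = g z) (germ_of f == germ_of g).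
Proof.
rewrite /germ_of -Quotient.idealrBE; apply: (iffP (asboolP _)); apply: filterS.
  by move=> z h Xz; apply/eqP; rewrite -subr_eq0; apply/eqP; apply: h.
by move=> z h Xz; transitivity (f z - g z) => //; rewrite h ?subrr.
Qed.

Lemma germ_of_repr (a : local_ring) : germ_of (repr a) = a.
Proof. exact: reprK. Qed.

Lemma residue_germ_of f : residue (germ_of f) = f (gpt X).
Proof.
have /eqP/germ_ofP/nbhs_singleton := germ_of_repr (germ_of f).
by apply; exact: gpt_in.
Qed.

Lemma germ_ofB f g : germ_of (f - g) = germ_of f - germ_of g.
Proof. exact: rmorphB. Qed.
Lemma germ_ofM f g : germ_of (f * g) = germ_of f * germ_of g.
Proof. exact: rmorphM. Qed.
Lemma germ_of1 : germ_of 1 = 1.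
Proof. exact: rmorph1. Qed.

Local Lemma residue_zmod : zmod_morphism residue.
Proof.
move=> a b; rewrite -[a]germ_of_repr -[b]germ_of_repr -germ_ofB.
by rewrite !residue_germ_of.
Qed.
Local Lemma residue_monoid : monoid_morphism residue.
Proof.
split=> [|a b]; first by rewrite -germ_of1 residue_germ_of.
rewrite -[a]germ_of_repr -[b]germ_of_repr -germ_ofM.
by rewrite !residue_germ_of.
Qed.
HB.instance Definition _ := GRing.isZmodMorphism.Build local_ring (Cplx R)
  residue residue_zmod.
HB.instance Definition _ := GRing.isMonoidMorphism.Build local_ring (Cplx R)
  residue residue_monoid.

End LocalRing.

(* Morphisms of germs in the sense of ringed spaces: continuous maps along    *)
(* which holomorphic functions pull back to (germs on Z of) holomorphic       *)
(* functions.                                                                 *)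
Record germ_morphism (R : realType) (l n : nat) (Z : germ R l) (X : germ R n) :=
  GermMorphism {
    gmap :> 'rV[Cplx R]_l -> 'rV[Cplx R]_n;
    gmap_pt : gmap (gpt Z) = gpt X;
    gmap_in : \forall w \near gpt Z, gset Z w -> gset X (gmap w);
    gmap_cont : gmap w @[w --> within (gset Z) (nbhs (gpt Z))] --> gpt X;
    gmap_holo : forall f : holo (gpt X), exists g : holo (gpt Z),
      \forall w \near gpt Z, gset Z w -> g w = f (gmap w)
  }.

Section Pullback.
Variables (R : realType) (l n : nat) (Z : germ R l) (X : germ R n).
Variable alpha : germ_morphism Z X.

(* alpha^* sends the class of f to the class of f \o alpha (pullbackE).       *)
Definition pullback (a : local_ring X) : local_ring Z :=
  germ_of (sval (cid (gmap_holo alpha (repr a)))).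

Lemma pullbackE (f : holo (gpt X)) (g : holo (gpt Z)) :
  (\forall w \near gpt Z, gset Z w -> g w = f (alpha w)) ->
  pullback (germ_of f) = germ_of g.
Proof.
move=> gf; apply/eqP/germ_ofP; case: cid => /= h hf.
have rf : \forall w \near gpt Z, gset Z w -> gset X (alpha w) ->
    (repr (germ_of f) : holo _) (alpha w) = f (alpha w).
  by have /eqP/germ_ofP/(gmap_cont alpha) := germ_of_repr (germ_of f).
near=> w => Zw; have Xw : gset X (alpha w) by apply: (near (gmap_in alpha) w).
rewrite (_ : h w = (repr (germ_of f) : holo _) (alpha w)); last exact: (near hf w).
rewrite (_ : g w = f (alpha w)); last exact: (near gf w).
by apply: (near rf w).
Unshelve. all: by end_near. Qed.

Lemma pullback_ex (a : local_ring X) : exists f (g : holo (gpt Z)),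
  [/\ a = germ_of f, pullback a = germ_of g &
      \forall w \near gpt Z, gset Z w -> g w = f (alpha w)].
Proof.
exists (repr a); have [g gf] := gmap_holo alpha (repr a).
by exists g; rewrite -[a in pullback a]germ_of_repr (pullbackE gf) germ_of_repr.
Qed.

Local Lemma pullback_zmod : zmod_morphism pullback.
Proof.
move=> a b; have [f [g [-> -> gf]]] := pullback_ex a.
have [f' [g' [-> -> gf']]] := pullback_ex b.
rewrite -!germ_ofB; apply: pullbackE; near=> w => Zw.
transitivity (g w - g' w) => //.
by rewrite (near gf w) ?(near gf' w).
Unshelve. all: by end_near. Qed.

Local Lemma pullback_monoid : monoid_morphism pullback.
Proof.
split; first by rewrite -!germ_of1; apply: pullbackE; apply: filterE.
move=> a b; have [f [g [-> -> gf]]] := pullback_ex a.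
have [f' [g' [-> -> gf']]] := pullback_ex b.
rewrite -!germ_ofM; apply: pullbackE; near=> w => Zw.
transitivity (g w * g' w) => //.
by rewrite (near gf w) ?(near gf' w).
Unshelve. all: by end_near. Qed.

HB.instance Definition _ := GRing.isZmodMorphism.Build
  (local_ring X) (local_ring Z) pullback pullback_zmod.
HB.instance Definition _ := GRing.isMonoidMorphism.Build
  (local_ring X) (local_ring Z) pullback pullback_monoid.

End Pullback.

Section Gluing.
Variables (R : realType) (n m l : nat).
Variables (X : germ R n) (Y : germ R m) (Z : germ R l).
Variables (alpha : germ_morphism Z X) (beta : germ_morphism Z Y).

(* The local ring of the pushout of alpha and beta.                           *)
Definition glue_ring : comNzRingType :=
  fiber_prod (pullback alpha) (pullback beta).

Definition glue_fst : {rmorphism glue_ring -> local_ring X} :=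
  @fiber_fst _ _ _ (pullback alpha) (pullback beta).
Definition glue_snd : {rmorphism glue_ring -> local_ring Y} :=
  @fiber_snd _ _ _ (pullback alpha) (pullback beta).

Definition glue_residue : {rmorphism glue_ring -> Cplx R} :=
  @residue R n X \o glue_fst.

(* P^X_W, P^X_Z, P^X_K and the series over the gluing V; K is ker alpha^*.    *)
Definition P_X_sub (W : radical_idealr (local_ring X)) : fps rat :=
  poincare (@residue R n X) (quot_mod W).
Definition P_X_Z : fps rat :=
  poincare (@residue R n X) (restr (pullback alpha) (local_ring Z)^o).
Definition P_X_K : fps rat :=
  poincare (@residue R n X) (ker_mod (pullback alpha)).

Definition P_V_sub (W : radical_idealr (local_ring X)) : fps rat :=
  poincare glue_residue (restr glue_fst (quot_mod W)).
Definition P_V_X : fps rat :=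
  poincare glue_residue (restr glue_fst (local_ring X)^o).
Definition P_V_Y : fps rat :=
  poincare glue_residue (restr glue_snd (local_ring Y)^o).
Definition P_V_K : fps rat :=
  poincare glue_residue (restr glue_fst (ker_mod (pullback alpha))).

Definition weakly_large_gluing : Prop := P_V_K = P_X_K * P_V_X.
Definition large_gluing : Prop :=
  large glue_residue (@residue R n X) glue_fst.

End Gluing.

(* Main.v *)
Require Import Defs.
From HB Require Import structures.
From mathcomp Require Import all_boot all_order all_algebra.
From mathcomp Require Import generic_quotient ring_quotient complex.
From mathcomp Require Import all_classical all_reals topology normedtype sequences.
From mathcomp Require Import interval_inference ring lra zify.

(* Let V be the gluing and K = ker alpha^*. As the kernel of O_V -> O_Y is K,
   viewed as an O_V-module, and the kernel of O_X -> O_Z is K too, and K lies in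
   the maximal ideals, P^V_Y = 1 + t P^V_K and P^X_Z = 1 + t P^X_K. If the gluing
   is weakly large then 1 - P^V_Y = (1 - P^X_Z) P^V_X, and 1 - P^X_Z <> 0 as
   K <> 0; this is (i). For (ii) it remains to see that large gluings are weakly
   large. Coefficientwise one always has P^V_K <= P^X_K P^V_X (change of rings)
   and P^V_Z <= P^V_X + t P^V_K (mapping cone), while largeness applied to the
   radical ideal K gives P^V_Z = P^X_Z P^V_X = P^V_X + t P^X_K P^V_X; hence both
   inequalities are equalities.

   The Betti numbers make sense because the local rings are Noetherian
   (Rueckert's basis theorem). Instead of Weierstrass preparation, which needs
   coordinate changes, the proof runs the argument of Hilbert's basis theorem for
   power series in the last variable, with the stronger induction hypothesis that
   on all small polydiscs the quotients can be chosen with norm at most a constant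
   times the norm of the dividend. *)

Set Implicit Arguments.
Unset Strict Implicit.
Unset Printing Implicit Defensive.

Import Order.TTheory GRing.Theory Num.Theory.
Import numFieldNormedType.Exports.

Local Open Scope ring_scope.

(** * Independence of the resolution *)

(** Why norms must be carried along: dividing a power series by generators performs infinitely many
    successive divisions of lowest coefficients in the ring with one variable less, so the quotients
    are a priori only formal. If each such division costs a factor C, then C stays fixed while the
    last radius, chosen after all the others, is shrunk until the higher coefficients of the
    generators contribute at most 1/2; a geometric argument then makes the quotients converge, again
    with a bound. Betti numbers are handled through explicit resolutions: every resolution bounds
    them from above by its ranks, and a minimal one attains them. The change of rings inequality
    thus needs neither spectral sequences nor long exact sequences of Tor. The denominator 1 - P^X_Z
    = - t P^X_K has no constant term, so the quotients in the theorem are not divisions by units of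
    the power series ring. *)

Section Comparison.
Variable R : comNzRingType.

(** Treating the augmentation as the differential leaving degree 0 gives exactness the single form
    [cycleP] in all degrees. *)
Definition cycle (M : lmodType R) (F : free_resolution M) i :
    'rV[R]_(frank F i) -> Prop :=
  match i return 'rV[R]_(frank F i) -> Prop with
  | 0 => fun u => faug F u = 0
  | j.+1 => fun u => u *m fdiff F j = 0
  end.

Lemma cycleP (M : lmodType R) (F : free_resolution M) i (u : 'rV_(frank F i)) :
  cycle u <-> exists w, u = w *m fdiff F i.
Proof. by case: i u => [|i] u; [exact: fexact0 | exact: fexactS]. Qed.

Lemma row_choice p q (P : 'rV[R]_p -> 'rV[R]_q -> Prop) :
  (forall u, exists w, P u w) -> exists W : 'M_(p, q), forall r, P (delta_mx 0 r) (row r W).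
Proof.
move=> /choice[w Pw]; exists (\matrix_r w (delta_mx 0 r)) => r.
by rewrite rowK.
Qed.

(** Free modules are projective: a preimage is chosen for each basis vector, that is, for each
    row. *)
Lemma lift_boundary (M : lmodType R) (F : free_resolution M) i p
    (A : 'M[R]_(p, frank F i)) :
  (forall u : 'rV_p, cycle (u *m A)) -> exists W, A = W *m fdiff F i.
Proof.
move=> cA; have [u|W WE] := row_choice (P := fun u w => u *m A = w *m fdiff F i).
  by have /cycleP := cA u.
by exists W; apply/row_matrixP => r; rewrite row_mul -WE rowE.
Qed.

Lemma fdiff_comp (M : lmodType R) (F : free_resolution M) i :
  fdiff F i.+1 *m fdiff F i = 0.
Proof.
apply/row_matrixP => r; rewrite row0 row_mul; apply/fexactS.
by exists (delta_mx 0 r); rewrite -rowE.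
Qed.

Lemma faug_fdiff (M : lmodType R) (F : free_resolution M) u :
  faug F (u *m fdiff F 0) = 0.
Proof. by apply/fexact0; exists u. Qed.

Definition chain_map (M N : lmodType R) (F : free_resolution M)
    (G : free_resolution N) (h : M -> N)
    (f : forall i, 'M[R]_(frank F i, frank G i)) :=
  (forall u, faug G (u *m f 0) = h (faug F u)) /\
  forall i, fdiff F i *m f i = f i.+1 *m fdiff G i.

Lemma lift_chain_map (M N : lmodType R) (F : free_resolution M)
    (G : free_resolution N) (h : {linear M -> N}) :
  exists f, @chain_map _ _ F G h f.
Proof.
pose ok i (f : 'M[R]_(frank F i, frank G i)) :=
  forall u, cycle u -> cycle (u *m f).
have [f0 f0E] : exists f0 : 'M_(frank F 0, frank G 0),
    forall u, faug G (u *m f0) = h (faug F u).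
  have [u|W WE] := row_choice (P := fun u w => faug G w = h (faug F u)).
    exact: faug_surj.
  exists W => u; rewrite mulmx_sum_row [in RHS](row_sum_delta u) !linear_sum.
  by apply: eq_bigr => r _; rewrite !linearZ /= WE.
have ok0 : ok 0 f0 by move=> u /= u0; rewrite f0E u0 linear0.
(* Each component is built together with the proof [ok] that it preserves cycles, since the next one
   lifts images of boundaries and these must be cycles. *)
have next i (f : {f | ok i f}) : {g : {g | ok i.+1 g} |
    fdiff F i *m sval f = sval g *m fdiff G i}.
  case: f => f okf /=; apply: cid.
  have [u|g gE] := lift_boundary (F := G) (A := fdiff F i *m f).
    by rewrite mulmxA; apply: okf; apply/cycleP; exists u.
  have okg : ok i.+1 g.
    by move=> u /= u0; rewrite -mulmxA -gE mulmxA u0 mul0mx.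
  by exists (exist _ g okg).
pose st := nat_rect (fun i => {f | ok i f}) (exist _ f0 ok0)
  (fun i f => sval (next i f)).
exists (fun i => sval (st i)); split=> // i.
exact: (svalP (next i (st i))).
Qed.

(* [s] is the degree i component of a contracting homotopy, whose next component
   lifts [f i.+1 - fdiff F i *m s]. *)
Lemma null_homotopic (M : lmodType R) (F : free_resolution M) f i :
  @chain_map _ _ F F (fun=> 0) f ->
  exists s, fdiff F i *m (f i - s *m fdiff F i) = 0.
Proof.
move=> [f0 fS]; elim: i => [|i [s sE]].
  have [u|s sE] := lift_boundary (F := F) (A := f 0%N); first exact: f0.
  by exists s; rewrite -sE subrr mulmx0.
have [u|t tE] := lift_boundary (F := F) (A := f i.+1 - fdiff F i *m s).
  move=> /=; rewrite -mulmxA mulmxBl -fS -mulmxA -mulmxBr sE mulmx0 //.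
exists t; rewrite -tE opprB addrCA subrr addr0 mulmxA.
by rewrite fdiff_comp mul0mx.
Qed.

End Comparison.

(** As [f] followed by [g] is the identity on cycles up to boundaries, [f] is injective on homology.
    Concretely, [f] embeds a complement [C] of the boundaries in the cycles into the cycles of the
    second complex, and the image meets the boundaries there only in 0. *)
Lemma homology_rank_le (k : fieldType) n0 n1 n2 m0 m1 m2
    (B : 'M[k]_(n2, n1)) (D : 'M[k]_(n1, n0))
    (B' : 'M[k]_(m2, m1)) (D' : 'M[k]_(m1, m0))
    (f0 : 'M[k]_(n0, m0)) (f : 'M[k]_(n1, m1)) (g : 'M[k]_(m1, n1))
    (g2 : 'M[k]_(m2, n2)) (s : 'M[k]_(n1, n2)) :
  D *m f0 = f *m D' -> B' *m g = g2 *m B ->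
  (forall u : 'rV_n1, u *m D = 0 -> (u *m (f *m g - 1%:M - s *m B) <= B)%MS) ->
  B *m D = 0 -> B' *m D' = 0 ->
  (\rank (kermx D) - \rank B <= \rank (kermx D') - \rank B')%N.
Proof.
move=> Df Bg hom BD BD'; pose C := (kermx D :\: B)%MS.
have sBK : (B <= kermx D)%MS by rewrite sub_kermx BD.
have sBK' : (B' <= kermx D')%MS by rewrite sub_kermx BD'.
have rC : (\rank (kermx D) - \rank B = \rank C)%N.
  by rewrite -(mxrank_cap_compl (kermx D) B) (capmx_idPr sBK) addKn.
have inj u : (u <= C)%MS -> (u *m f <= B')%MS -> u = 0 :> 'rV_n1.
  move=> uC ufB; apply/eqP; rewrite -submx0 -(capmx_diff (kermx D) B).
  rewrite sub_capmx uC /=.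
  have uD : u *m D = 0.
    by apply/eqP; rewrite -sub_kermx (submx_trans uC) ?diffmxSl.
  have := hom u uD; rewrite !mulmxBr mulmx1.
  have ufgB : (u *m (f *m g) <= B)%MS.
    have [w wE] := submxP ufB.
    by rewrite mulmxA wE -mulmxA Bg mulmxA submxMl.
  set X := _ - _ => XB.
  rewrite (_ : u = u *m (f *m g) - u *m (s *m B) - X); last first.
    by rewrite /X opprB addrA subrK opprB addrC subrK.
  by rewrite !addmx_sub ?eqmx_opp // mulmxA submxMl.
have CB0 : (C *m f :&: B')%MS = 0.
  apply/eqP; rewrite -submx0; apply/row_subP => i.
  have := row_sub i (C *m f :&: B')%MS; rewrite sub_capmx => /andP[/submxP[w wE] sB].
  have : w *m C = 0 by apply: inj; [exact: submxMl | rewrite -mulmxA -wE].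
  by move=> w0; rewrite wE mulmxA w0 mul0mx sub0mx.
have Cf : \rank (C *m f) = \rank C.
  apply/mxrank_injP; rewrite -submx0; apply/row_subP => i.
  have := row_sub i (C :&: kermx f)%MS; rewrite sub_capmx sub_kermx => /andP[uC /eqP u0].
  by rewrite (inj _ uC) ?sub0mx // u0 sub0mx.
rewrite rC leq_subRL ?mxrankS // addnC -Cf -mxrank_disjoint_sum //.
rewrite mxrankS // addsmx_sub sBK' andbT sub_kermx -mulmxA -Df mulmxA.
have /eqP-> : C *m D == 0 by rewrite -sub_kermx diffmxSl.
by rewrite mul0mx.
Qed.

Section Betti.
Variables (R : comNzRingType) (k : fieldType) (eps : {rmorphism R -> k}).

(** [M] is a retract of [N]. The composite of lifts of [g] and [h] differs from the identity by a
    lift [e] of the zero map; [e] is null homotopic, and a homotopy survives reduction along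
    [eps]. *)
Lemma tor_dim_le (M N : lmodType R) (g : {linear M -> N}) (h : {linear N -> M})
    (F : free_resolution M) (G : free_resolution N) i :
  cancel g h -> (tor_dim eps F i <= tor_dim eps G i)%N.
Proof.
move=> gK; have [f [f0 fS]] := lift_chain_map F G g.
have [f' [f'0 f'S]] := lift_chain_map G F h.
pose e i := f i *m f' i - 1%:M.
have e_chain : @chain_map _ _ _ F F (fun=> 0) e.
  split=> [u|j].
    by rewrite mulmxBr mulmx1 raddfB /= mulmxA f'0 f0 gK subrr.
  by rewrite mulmxBr mulmxBl mul1mx mulmx1 mulmxA fS -mulmxA f'S mulmxA.
have toK (m n p : nat) (A : 'M[R]_(m, n)) (B : 'M_(n, p)) :
  map_mx eps A *m map_mx eps B = map_mx eps (A *m B) by rewrite map_mxM.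
case: i => [|i].
  have [s sE] : exists s, e 0%N = s *m fdiff F 0.
    by apply: lift_boundary => u; exact: (proj1 e_chain).
  (* In degree 0 all vectors count as cycles: this is the kernel of a map to the zero space. *)
  have K0 n : n = \rank (kermx (0 : 'M[k]_(n, 0))).
    by rewrite mxrank_ker mxrank0 subn0.
  rewrite /tor_dim; have := K0 (frank F 0); have := K0 (frank G 0).
  move=> {1}-> {1}->.
  apply: (@homology_rank_le _ _ _ _ _ _ _ _ _ _ _ 0 (map_mx eps (f 0%N))
     (map_mx eps (f' 0%N)) (map_mx eps (f' 1%N)) (map_mx eps s)).
  - by rewrite mul0mx mulmx0.
  - by rewrite !toK f'S.
  - move=> u _; rewrite !toK -sE /e map_mxB map_mx1 subrr mulmx0 sub0mx //.
  - by rewrite mulmx0.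
  - by rewrite mulmx0.
have [s sE] := null_homotopic i e_chain.
have [u|t tE] := lift_boundary (F := F) (A := e i.+1 - fdiff F i *m s).
  by rewrite /= -mulmxA mulmxBl -(proj2 e_chain) -mulmxA -mulmxBr sE mulmx0.
apply: (@homology_rank_le _ _ _ _ _ _ _ _ _ _ _ (map_mx eps (f i))
    (map_mx eps (f i.+1)) (map_mx eps (f' i.+1)) (map_mx eps (f' i.+2))
    (map_mx eps t)).
- by rewrite !toK fS.
- by rewrite !toK f'S.
- move=> u u0; rewrite !toK -tE /e !map_mxB map_mx1 opprB addrCA subrr addr0.
  by rewrite -toK mulmxA u0 mul0mx sub0mx.
- by rewrite toK fdiff_comp map_mx0.
- by rewrite toK fdiff_comp map_mx0.
Qed.

Lemma tor_dim_iso (M N : lmodType R) (g : {linear M -> N}) (h : {linear N -> M})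
    (F : free_resolution M) (G : free_resolution N) i :
  cancel g h -> cancel h g -> tor_dim eps F i = tor_dim eps G i.
Proof.
by move=> gK hK; apply/eqP; rewrite eqn_leq (tor_dim_le _ _ _ gK) (tor_dim_le _ _ _ hK).
Qed.

(** The resolution picked by [xget] is unknown, but the identity of [M] compares it with [F]. *)
Lemma bettiE (M : lmodType R) (F : free_resolution M) i :
  betti eps M i = tor_dim eps F i.
Proof.
rewrite /betti; case: xgetP => [d _ [G ->]|]; last first.
  by move=> /(_ (tor_dim eps F i)) h; exfalso; apply: h; exists F.
exact: (@tor_dim_iso M M idfun idfun).
Qed.

Lemma tor_dim_leq_frank (M : lmodType R) (F : free_resolution M) i :
  (tor_dim eps F i <= frank F i)%N.
Proof.
case: i => [|i]; first exact: leq_subr.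
by rewrite (leq_trans (leq_subr _ _)) // rank_leq_row.
Qed.

End Betti.

(** * Noetherian modules and minimal resolutions *)

Section Noetherian.
Variable R : comNzRingType.
Implicit Types M : lmodType R.

Definition submodule M (N : M -> Prop) :=
  N 0 /\ forall a u v, N u -> N v -> N (a *: u + v).

Definition generates M (N : M -> Prop) p (v : 'I_p -> M) :=
  forall x, N x <-> exists c : 'rV[R]_p, x = \sum_j c 0 j *: v j.

Definition finitely_generated M (N : M -> Prop) :=
  exists p (v : 'I_p -> M), generates N v.

Definition noetherian M :=
  forall N : M -> Prop, submodule N -> finitely_generated N.

Lemma submodule_sum M (N : M -> Prop) p (v : 'I_p -> M) (c : 'I_p -> R) :
  submodule N -> (forall j, N (v j)) -> N (\sum_j c j *: v j).
Proof.
move=> [N0 Nlin] Nv; elim/big_ind: _ => // [x y Nx Ny|j _].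
  by rewrite -[x]scale1r; apply: Nlin.
by rewrite -[_ *: _]addr0; apply: Nlin.
Qed.

Lemma generates_mem M (N : M -> Prop) p (v : 'I_p -> M) j :
  generates N v -> N (v j).
Proof.
move=> /(_ (v j)) [_]; apply; exists (delta_mx 0 j).
rewrite (bigD1 j) //= mxE !eqxx scale1r big1 ?addr0 // => i /negPf ij.
by rewrite mxE ij andbF scale0r.
Qed.

Definition to_linear (M M' : lmodType R) (f : M -> M') (lf : linear f) :
  {linear M -> M'} := HB.pack f (GRing.isLinear.Build R M M' _ f lf).

(** Lifts of generators of the image of [N], together with generators of the part of [N] killed by
    [f], generate [N]. Speaking of submodules on which [f] vanishes avoids forming the kernel as a
    module. *)
Lemma noetherian_extension (M M' : lmodType R) (f : M -> M') :
  linear f -> noetherian M' ->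
  (forall N : M -> Prop, submodule N -> (forall x, N x -> f x = 0) ->
     finitely_generated N) ->
  noetherian M.
Proof.
move=> lf noe kfg N sN; have [N0 Nlin] := sN.
pose F : {linear M -> M'} := to_linear lf; have FE : f =1 F by [].
have [|p [w /= wE]] := noe (fun y => exists2 x, N x & y = f x).
  split; first by exists 0; rewrite // FE linear0.
  move=> a _ _ [x Nx ->] [y Ny ->]; exists (a *: x + y); first exact: Nlin.
  by rewrite lf.
have /choice[x xE] j : exists x, N x /\ w j = f x.
  by have [x] := generates_mem j wE; exists x.
have [||q [v vE]] := kfg (fun x => N x /\ f x = 0).
- split; first by rewrite FE linear0.
  by move=> a u u' [Nu u0] [Nu' u'0]; split; [exact: Nlin | rewrite lf u0 u'0 scaler0 addr0].
- by move=> ? [].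
have Nv j : N (v j) by have [] := generates_mem j vE.
exists (p + q)%N, (fun j : 'I_(p + q) => match fintype.split j with inl i => x i | inr i => v i end).
have sumE (c : 'rV[R]_(p + q)) : \sum_(j < p + q) c 0 j *: match fintype.split j with inl i => x i | inr i => v i end
    = \sum_j c 0 (lshift q j) *: x j + \sum_j c 0 (rshift p j) *: v j.
  rewrite big_split_ord /=; congr (_ + _); apply: eq_bigr => j _.
    by rewrite (unsplitK (inl j)).
  by rewrite (unsplitK (inr j)).
move=> y; split=> [Ny|[c ->]]; last first.
  rewrite sumE -[X in X + _]scale1r; apply: Nlin; apply: submodule_sum => // j.
  by have [] := xE j.
have /wE[c cE] : exists2 x, N x & f y = f x by exists y.
have Nd : N (y - \sum_j c 0 j *: x j) /\ f (y - \sum_j c 0 j *: x j) = 0.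
  split.
    rewrite addrC -scaleN1r; apply: Nlin => //; apply: submodule_sum => // j.
    by have [] := xE j.
  rewrite FE linearB [F y]cE linear_sum -sumrB big1 // => j _.
  by rewrite linearZ (xE j).2 subrr.
have /vE[d dE] := Nd.
exists (row_mx c d); rewrite sumE.
under eq_bigr do rewrite row_mxEl.
under [X in _ + X]eq_bigr do rewrite row_mxEr.
by rewrite -dE addrC subrK.
Qed.

(** Injectivity is asked on [N] only, because the maps used later (dropping the first coordinate, or
    the second projection of a fiber product) are injective just on the kernel of another map. *)
Lemma noetherian_embedding (M M' : lmodType R) (f : M -> M')
    (N : M -> Prop) : linear f -> noetherian M' -> submodule N ->
  (forall x y, N x -> N y -> f x = f y -> x = y) -> finitely_generated N.
Proof.
move=> lf noe sN finj; have [N0 Nlin] := sN.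
pose F : {linear M -> M'} := to_linear lf.
have sumE p (c : 'rV_p) (v : 'I_p -> M) :
    f (\sum_j c 0 j *: v j) = \sum_j c 0 j *: f (v j).
  by rewrite [LHS](linear_sum F); apply: eq_bigr => j _; exact: (linearZZ F).
have [|p [w wE]] := noe (fun y => exists2 x, N x & y = f x).
  split; first by exists 0; rewrite // [RHS](linear0 F).
  move=> a _ _ [x Nx ->] [y Ny ->]; exists (a *: x + y); first exact: Nlin.
  by rewrite lf.
have /choice[v vE] j : exists x, N x /\ w j = f x.
  by have [x] := generates_mem j wE; exists x.
have Nv c : N (\sum_(j < p) c j *: v j).
  by apply: submodule_sum => // j; have [] := vE j.
exists p, v => x; split=> [Nx|[c ->//]].
have /wE[c cE] : exists2 y, N y & f x = f y by exists x.
exists c; apply: finj => //; rewrite sumE cE; apply: eq_bigr => j _.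
by have [_ <-] := vE j.
Qed.

Lemma noetherian_rV n : noetherian R^o -> noetherian 'rV[R]_n.
Proof.
move=> noe; elim: n => [|n IHn].
  move=> N [N0 _]; exists 0%N, (fun _ => 0) => x.
  by rewrite [x]thinmx0; split=> // _; exists 0; rewrite big_ord0.
apply: (@noetherian_extension _ R^o (fun u : 'rV[R]_(1 + n) => u 0 0)) => //.
  by move=> a u v /=; rewrite !mxE.
move=> N sN Nker.
apply: (@noetherian_embedding _ _ (@rsubmx R 1 1 n) N _ IHn sN).
  by move=> a u v; apply/rowP => i; rewrite !mxE.
move=> x y /Nker x0 /Nker y0 xy; rewrite -[x](@hsubmxK _ 1 1) -[y](@hsubmxK _ 1 1) xy.
have first0 (z : 'rV[R]_(1 + n)) : z 0 0 = 0 -> lsubmx z = 0.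
  move=> z0; apply/rowP => i; rewrite !mxE ord1 -[RHS]z0; congr (z _ _).
  exact/val_inj.
by rewrite !first0.
Qed.

End Noetherian.

(** Surjectivity makes the submodules over both rings the same. *)
Lemma noetherian_restr (R S : comNzRingType) (phi : {rmorphism R -> S})
    (M : lmodType S) :
  (forall b, exists a, phi a = b) -> noetherian M -> noetherian (restr phi M).
Proof.
move=> phi_surj noe N [N0 Nlin].
have [|p [v vE]] := noe N.
  by split=> // b u w; have [a <-] := phi_surj b; apply: Nlin.
exists p, v => x; split=> [/vE[c ->]|[c ->]].
  have /choice[a aE] j := phi_surj (c 0 j).
  by exists (\row_j a j); apply: eq_bigr => j _; rewrite mxE -aE.
apply/vE; exists (\row_j phi (c 0 j)); apply: eq_bigr => j _.
by rewrite mxE.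
Qed.

Section Minimal.
Variables (R : comNzRingType) (k : fieldType) (eps : {rmorphism R -> k}).
Hypothesis loc : forall a, eps a != 0 -> exists b, b * a = 1.
Hypothesis noe : noetherian R^o.

(** In a generating family of least size no relation has an invertible coefficient: it would express
    one generator through the others. *)
Lemma minimal_generators (M : lmodType R) (N : M -> Prop) :
  finitely_generated N -> exists p (v : 'I_p -> M), generates N v /\
    forall c : 'rV_p, \sum_j c 0 j *: v j = 0 -> map_mx eps c = 0.
Proof.
move=> [p0 [v0 v0E]].
pose P p := `[< exists v : 'I_p -> M, generates N v >].
have exP : exists p, P p by exists p0; apply/asboolP; exists v0.
have [p /asboolP[v vE] pmin] := ex_minnP exP; exists p, v; split=> // c c0.
apply/rowP => j; rewrite !mxE; apply/eqP; apply: contraT => /loc[b bE].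
exfalso; case: p v vE pmin c c0 j bE => [|p] v vE pmin c c0 j bE; first by case: j {bE}.
suff /asboolP/pmin : exists w : 'I_p -> M, generates N w by rewrite ltnn.
exists (v \o lift j) => x.
have vj : v j = \sum_(i < p) (- (b * c 0 (lift j i))) *: v (lift j i).
  move/(congr1 ( *:%R b)): c0; rewrite scaler0 (bigD1_ord j) //= scalerDr scalerA bE.
  rewrite scale1r => /eqP; rewrite addr_eq0 => /eqP->.
  by rewrite scaler_sumr -sumrN; apply: eq_bigr => i _; rewrite scalerA scaleNr.
rewrite (vE x); split=> -[d ->].
  exists (\row_i (d 0 (lift j i) - d 0 j * (b * c 0 (lift j i)))).
  rewrite (bigD1_ord j) //= vj scaler_sumr -big_split /=; apply: eq_bigr => i _.
  by rewrite mxE scalerA -scalerDl mulrN addrC.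
exists (\row_i (if unlift j i is Some i' then d 0 i' else 0)).
rewrite (bigD1_ord j) //= mxE unlift_none scale0r add0r.
by apply: eq_bigr => i _; rewrite mxE liftK.
Qed.

Lemma minimal_kernel p (M : lmodType R) (h : {linear 'rV[R]_p -> M}) :
  exists q (B : 'M[R]_(q, p)), (forall u, h u = 0 <-> exists w, u = w *m B) /\
    forall w : 'rV_q, w *m B = 0 -> map_mx eps w = 0.
Proof.
have [|q [v [vE vmin]]] := @minimal_generators _ (fun u => h u = 0).
  apply: noetherian_rV => //; split=> [|a u w u0 w0]; first by rewrite linear0.
  by rewrite linearP u0 w0 scaler0 addr0.
have sE w : w *m (\matrix_i v i) = \sum_i w 0 i *: v i.
  by rewrite mulmx_sum_row; apply: eq_bigr => i _; rewrite rowK.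
exists q, (\matrix_i v i); split=> [u|w]; last by rewrite sE; exact: vmin.
by rewrite vE; split=> -[w ->]; exists w; rewrite sE.
Qed.

Definition minimal (M : lmodType R) (F : free_resolution M) :=
  forall i, map_mx eps (fdiff F i) = 0.

Lemma tor_dim_minimal (M : lmodType R) (F : free_resolution M) i :
  minimal F -> tor_dim eps F i = frank F i.
Proof.
move=> F0; rewrite /tor_dim F0 mxrank0 subn0; case: i => // i.
by rewrite F0 mxrank_ker mxrank0 subn0.
Qed.

Lemma minimal_resolution_of (M : lmodType R) p (h : {linear 'rV[R]_p -> M}) :
  (forall x, exists u, h u = x) -> (forall u, h u = 0 -> map_mx eps u = 0) ->
  exists2 F : free_resolution M, minimal F & frank F 0 = p.
Proof.
move=> hsurj hmin.
have [q [B [BE Bmin]]] := minimal_kernel h.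
have next a b (A : 'M[R]_(a, b)) : {c & {C : 'M[R]_(c, a) |
    (forall u : 'rV_a, u *m A = 0 <-> exists w, u = w *m C) /\
    forall w : 'rV_c, w *m C = 0 -> map_mx eps w = 0}}.
  have := minimal_kernel (mulmxr A : {linear 'rV_a -> 'rV_b}).
  by move=> /cid[c] /cid CE; exists c.
(* A state is a matrix with its two sizes. The new number of columns is by definition the old number
   of rows, so consecutive differentials in [d] compose without casts. *)
pose st := nat_rect (fun=> {b & {a & 'M[R]_(a, b)}})
  (existT _ p (existT _ q B))
  (fun _ s => existT _ (tag (tagged s)) (existT _ (tag (next _ _ (tagged (tagged s))))
     (sval (tagged (next _ _ (tagged (tagged s))))))).
pose d i : 'M[R]_(tag (st i.+1), tag (st i)) := tagged (tagged (st i)).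
have dmin i (w : 'rV_(tag (st i.+1))) : w *m d i = 0 -> map_mx eps w = 0.
  case: i w => [|i] w; first exact: Bmin.
  exact: (svalP (tagged (next _ _ (d i)))).2.
have dE i (u : 'rV_(tag (st i.+1))) : u *m d i = 0 <-> exists w, u = w *m d i.+1.
  exact: (svalP (tagged (next _ _ (d i)))).1.
(* The rows of each differential are relations for the preceding map, whose relations all reduce to
   0; this is minimality. *)
pose F := @FreeResolution R M (fun i => tag (st i)) h d hsurj BE dE.
exists F => // i; apply/row_matrixP => r; rewrite -map_row row0.
case: i r => [|i] r.
  by apply: hmin; apply/BE; exists (delta_mx 0 r); rewrite -rowE.
by apply: (dmin i); apply/dE; exists (delta_mx 0 r); rewrite -rowE.
Qed.

Definition fg_module (M : lmodType R) := finitely_generated (fun _ : M => True).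

Lemma minimal_presentation (M : lmodType R) : fg_module M ->
  exists p (h : {linear 'rV[R]_p -> M}),
  (forall x, exists u, h u = x) /\ (forall u, h u = 0 -> map_mx eps u = 0).
Proof.
move=> /minimal_generators[p [v [vE vmin]]].
have lh : linear (fun u : 'rV[R]_p => \sum_j u 0 j *: v j).
  move=> a u w; rewrite scaler_sumr -big_split /=; apply: eq_bigr => j _.
  by rewrite !mxE scalerDl scalerA.
exists p, (to_linear lh); split=> //= x.
by have [/(_ I)[c ->] _] := vE x; exists c.
Qed.

Lemma minimal_resolution (M : lmodType R) :
  fg_module M -> exists F : free_resolution M, minimal F.
Proof.
move=> /minimal_presentation[p [h [hs hm]]].
by have [F Fm _] := minimal_resolution_of hs hm; exists F.
Qed.

Lemma fg_module_noetherian (M : lmodType R) : noetherian M -> fg_module M.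
Proof. by apply; split. Qed.

(** All upper bounds below come from writing down a resolution, minimal or not, and counting
    ranks. *)
Lemma betti_leq_frank (M : lmodType R) (F : free_resolution M) i :
  (betti eps M i <= frank F i)%N.
Proof. by rewrite (bettiE eps F) tor_dim_leq_frank. Qed.

Lemma betti_minimal (M : lmodType R) (F : free_resolution M) i :
  minimal F -> betti eps M i = frank F i.
Proof. by move=> /tor_dim_minimal <-; exact: bettiE. Qed.

End Minimal.

(** * Bounds on Betti numbers *)

Section LinearKernel.
Variables (R : comNzRingType) (U V : lmodType R) (h : {linear U -> V}).

Definition in_lkernel : {pred U} := [pred u | h u == 0].

Local Lemma in_lkernel_closed : submod_closed in_lkernel.
Proof.
split=> [|a u v]; rewrite !inE ?linear0 // => /eqP u0 /eqP v0.
by rewrite linearP u0 v0 scaler0 addr0.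
Qed.

HB.instance Definition _ := GRing.isSubmodClosed.Build R U in_lkernel
  in_lkernel_closed.

Record lkernel := LKernel { lkernel_val :> U; _ : lkernel_val \in in_lkernel }.
HB.instance Definition _ := [isSub for lkernel_val].
HB.instance Definition _ := [Choice of lkernel by <:].
HB.instance Definition _ := [SubChoice_isSubLmodule of lkernel by <:].

Lemma lkernel_fg : finitely_generated (fun u => h u = 0) -> fg_module lkernel.
Proof.
move=> [p [v vE]].
have v0 j : v j \in in_lkernel by rewrite inE; apply/eqP/(generates_mem j vE).
exists p, (fun j => LKernel (v0 j)) => x; split=> // _.
have /vE[c cE] : h (val x) = 0 by apply/eqP; exact: (valP x).
by exists c; apply: val_inj; rewrite cE raddf_sum.
Qed.

End LinearKernel.

Section Syzygy.
Variables (R : comNzRingType) (k : fieldType) (eps : {rmorphism R -> k}).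
Variables (K M : lmodType R) (p : nat).
Variables (j : {linear K -> 'rV[R]_p}) (h : {linear 'rV[R]_p -> M}).
Hypotheses (j_inj : injective j) (h_surj : forall x, exists u, h u = x).
Hypothesis hj : forall u, h u = 0 <-> exists x, u = j x.
Hypothesis j_eps : forall x, map_mx eps (j x) = 0.

(** [F] is continued by the free module that covers [M]. The new differential reduces to 0 because
    [K] lies in the maximal ideal times this module, so Tor of [M] is Tor of [K] moved up by one
    degree. *)
Lemma splice_resolution (F : free_resolution K) :
  exists G : free_resolution M, tor_dim eps G 0 = p /\
    forall i, tor_dim eps G i.+1 = tor_dim eps F i.
Proof.
pose D : 'M[R]_(frank F 0, p) := lin1_mx (j \o faug F).
have DE u : u *m D = j (faug F u) by rewrite mul_rV_lin1.
pose d i := match i return 'M[R]_(frank F i, if i is l.+1 then frank F l else p) with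
  | 0 => D | l.+1 => fdiff F l end.
have D0 : map_mx eps D = 0.
  by apply/row_matrixP => r; rewrite -map_row row0 rowE DE.
pose G := @FreeResolution R M (fun i => if i is l.+1 then frank F l else p) h d.
have e0 u : h u = 0 <-> exists w, u = w *m d 0%N.
  rewrite hj; split=> [[x ->]|[w ->]]; last by rewrite /= DE; exists (faug F w).
  by have [w <-] := faug_surj F x; exists w; rewrite /= DE.
have eS i (u : 'rV[R]_(frank F i)) : u *m d i = 0 <-> exists w, u = w *m d i.+1.
  case: i u => [|i] u; last exact: fexactS.
  by rewrite /= DE -(linear0 j) -fexact0; split=> [/j_inj|->].
exists (G h_surj e0 eS); split; first by rewrite /tor_dim /= D0 mxrank0 subn0.
by case=> // ; rewrite /tor_dim /= D0 mxrank_ker mxrank0 subn0.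
Qed.

End Syzygy.

Section Cone.
Variables (R : comNzRingType) (A B C : lmodType R).
Variables (j : {linear A -> B}) (h : {linear B -> C}).
Hypotheses (j_inj : injective j) (h_surj : forall x, exists u, h u = x).
Hypothesis hj : forall u, h u = 0 <-> exists x, u = j x.

(* Mapping cone of a lift of j. *)
Lemma cone_resolution (F : free_resolution A) (G : free_resolution B) :
  exists H : free_resolution C, frank H 0 = frank G 0 /\
    forall i, frank H i.+1 = (frank F i + frank G i.+1)%N.
Proof.
have [f [f0 fS]] := lift_chain_map F G j.
(* The cone shifts [F] by one degree, so only [G] contributes in degree 0. *)
pose r i := if i is l.+1 then (frank F l + frank G l.+1)%N else frank G 0.
pose d i : 'M[R]_(r i.+1, r i) := match i with
  | 0 => col_mx (f 0%N) (fdiff G 0)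
  | l.+1 => block_mx (- fdiff F l) (f l.+1) 0 (fdiff G l.+1) end.
have d0E w v : row_mx w v *m d 0%N = w *m f 0%N + v *m fdiff G 0.
  exact: mul_row_col.
have dSE i w v : row_mx w v *m d i.+1 =
    row_mx (- (w *m fdiff F i)) (w *m f i.+1 + v *m fdiff G i.+1).
  by rewrite /d mul_row_block mulmx0 addr0 mulmxN.
have a_surj x : exists u, (h \o faug G) u = x.
  by have [y <-] := h_surj x; have [u <-] := faug_surj G y; exists u.
have e0 u : (h \o faug G) u = 0 <-> exists w, u = w *m d 0%N.
  rewrite /= hj; split=> [[x xE]|[w ->]].
    have [w wE] := faug_surj F x.
    have : faug G (u - w *m f 0%N) = 0 by rewrite linearB /= f0 wE xE subrr.
    move=> /fexact0[v vE]; exists (row_mx w v).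
    by rewrite d0E -vE addrC subrK.
  exists (faug F (lsubmx w)); rewrite -[w]hsubmxK d0E row_mxKl linearD /= f0.
  by rewrite faug_fdiff addr0.
have eS i (u : 'rV[R]_(r i.+1)) : u *m d i = 0 <-> exists w, u = w *m d i.+1.
  split=> [|[w ->]].
    rewrite -[u]hsubmxK; move: (lsubmx u) (rsubmx u) => {u} w v u0.
    have [w' wE] : exists w', w = w' *m fdiff F i.
      case: i w v u0 => [|i] w v.
        rewrite d0E => /(congr1 (faug G)); rewrite linearD /= f0 faug_fdiff addr0.
        by rewrite linear0 -(linear0 j) => /j_inj/fexact0.
      rewrite dSE -(row_mx0 _ 1 (frank F i)) => /eq_row_mx[/eqP].
      by rewrite oppr_eq0 => /eqP/fexactS.
    have [v' vE] : exists v', v + w' *m f i.+1 = v' *m fdiff G i.+1.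
      apply/fexactS; rewrite mulmxDl -mulmxA -fS mulmxA -wE addrC.
      case: i w v u0 w' wE => [|i] w v; first by rewrite d0E.
      by rewrite dSE -(row_mx0 _ 1 (frank F i)) => /eq_row_mx[].
    exists (row_mx (- w') v'); rewrite dSE !mulNmx opprK -wE -vE.
    by rewrite addrC addrK.
  rewrite -[w]hsubmxK dSE; case: i w {u} => [|i] w.
    by rewrite d0E mulmxDl mulNmx -!mulmxA fS fdiff_comp mulmx0 addr0 addNr.
  rewrite dSE mulmxDl !mulNmx -!mulmxA !fdiff_comp !mulmx0 !oppr0 addr0.
  by rewrite fS addNr row_mx0.
by exists (@FreeResolution R C r _ d a_surj e0 eS).
Qed.

End Cone.

Section DirectSum.
Variables (R : comNzRingType) (A B C : lmodType R).
Variables (j : {linear A -> C}) (h : {linear B -> C}).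
Hypothesis jh_inj : forall a b, j a + h b = 0 -> a = 0 /\ b = 0.
Hypothesis jh_surj : forall c, exists a b, j a + h b = c.

Lemma direct_sum_resolution (F : free_resolution A) (G : free_resolution B) :
  exists H : free_resolution C, forall i, frank H i = (frank F i + frank G i)%N.
Proof.
pose d i := block_mx (fdiff F i) 0 0 (fdiff G i).
have dE i w v : row_mx w v *m d i = row_mx (w *m fdiff F i) (v *m fdiff G i).
  by rewrite mul_row_block !mulmx0 addr0 add0r.
have la : linear (fun u : 'rV_(frank F 0 + frank G 0) =>
    j (faug F (lsubmx u)) + h (faug G (rsubmx u))).
  by move=> a u v; rewrite !linearP scalerDr addrACA.
have a_surj x : exists u, to_linear la u = x.
  have [a [b <-]] := jh_surj x; have [u <-] := faug_surj F a.
  by have [v <-] := faug_surj G b; exists (row_mx u v); rewrite /= row_mxKl row_mxKr.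
have e0 u : to_linear la u = 0 <-> exists w, u = w *m d 0%N.
  rewrite /=; split=> [/jh_inj[/fexact0[w wE] /fexact0[v vE]]|[w ->]].
    by exists (row_mx w v); rewrite dE -wE -vE hsubmxK.
  by rewrite -[w]hsubmxK dE row_mxKl row_mxKr !faug_fdiff !linear0 addr0.
have eS i (u : 'rV[R]_(frank F i.+1 + frank G i.+1)) :
    u *m d i = 0 <-> exists w, u = w *m d i.+1.
  split=> [|[w ->]].
    rewrite -[u]hsubmxK dE -(row_mx0 _ 1).
    move=> /eq_row_mx[/fexactS[w ->] /fexactS[v ->]].
    by exists (row_mx w v); rewrite dE.
  by rewrite -[w]hsubmxK !dE -!mulmxA !fdiff_comp !mulmx0 row_mx0.
by exists (@FreeResolution R C _ _ d a_surj e0 eS).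
Qed.

End DirectSum.

Lemma zero_resolution (R : comNzRingType) (M : lmodType R) :
  (forall x : M, x = 0) -> exists F : free_resolution M, forall i, frank F i = 0%N.
Proof.
move=> M0.
pose z : {linear 'rV[R]_0 -> M} := \0.
have a_surj x : exists u, z u = x by exists 0; rewrite (M0 x).
have e0 u : z u = 0 <-> exists w, u = w *m (0 : 'M[R]_0).
  by split=> // _; exists 0; rewrite mulmx0 [u]thinmx0.
have eS (i : nat) (u : 'rV[R]_0) :
    u *m (0 : 'M[R]_0) = 0 <-> exists w, u = w *m (0 : 'M[R]_0).
  by split=> _; [exists 0; rewrite mulmx0 [u]thinmx0 | rewrite mulmx0].
by exists (@FreeResolution R M (fun=> 0%N) z (fun=> 0) a_surj e0 eS).
Qed.

Section BettiBounds.
Variables (R : comNzRingType) (k : fieldType) (eps : {rmorphism R -> k}).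
Hypothesis loc : forall a, eps a != 0 -> exists b, b * a = 1.
Hypothesis noe : noetherian R^o.

Let minres (M : lmodType R) := @minimal_resolution R k eps loc noe M.

Lemma betti_syzygy (K M : lmodType R) p (j : {linear K -> 'rV[R]_p})
    (h : {linear 'rV[R]_p -> M}) :
  injective j -> (forall x, exists u, h u = x) ->
  (forall u, h u = 0 <-> exists x, u = j x) ->
  (forall x, map_mx eps (j x) = 0) -> fg_module K ->
  betti eps M 0 = p /\ forall i, betti eps M i.+1 = betti eps K i.
Proof.
move=> j_inj h_surj hj j_eps /minres[F Fm].
have [G [G0 GS]] := splice_resolution j_inj h_surj hj j_eps F.
by split=> [|i]; rewrite (bettiE eps G) // (bettiE eps F).
Qed.

(** The cone on minimal resolutions need not be minimal, whence an inequality. *)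
Lemma betti_quotient (A B C : lmodType R) (j : {linear A -> B})
    (h : {linear B -> C}) i :
  injective j -> (forall x, exists u, h u = x) ->
  (forall u, h u = 0 <-> exists x, u = j x) ->
  fg_module A -> fg_module B ->
  (betti eps C i <= betti eps B i + (if i is l.+1 then betti eps A l else 0))%N.
Proof.
move=> j_inj h_surj hj /minres[F Fm] /minres[G Gm].
have [H [H0 HS]] := cone_resolution j_inj h_surj hj F G.
apply: leq_trans (betti_leq_frank eps H i) _.
case: i => [|i]; first by rewrite H0 (betti_minimal _ Gm) addn0.
by rewrite HS (betti_minimal _ Gm) (betti_minimal _ Fm) addnC.
Qed.

Lemma betti_direct_sum (A B C : lmodType R) (j : {linear A -> C})
    (h : {linear B -> C}) i :
  (forall a b, j a + h b = 0 -> a = 0 /\ b = 0) ->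
  (forall c, exists a b, j a + h b = c) ->
  fg_module A -> fg_module B ->
  (betti eps C i <= betti eps A i + betti eps B i)%N.
Proof.
move=> jh_inj jh_surj /minres[F Fm] /minres[G Gm].
have [H HE] := direct_sum_resolution jh_inj jh_surj F G.
apply: leq_trans (betti_leq_frank eps H i) _.
by rewrite HE (betti_minimal _ Fm) (betti_minimal _ Gm).
Qed.

End BettiBounds.

Section ChangeOfRings.
Variables (R S : comNzRingType) (k : fieldType).
Variables (epsR : {rmorphism R -> k}) (epsS : {rmorphism S -> k}).
Variable phi : {rmorphism R -> S}.
Hypothesis locR : forall a, epsR a != 0 -> exists b, b * a = 1.
Hypothesis locS : forall a, epsS a != 0 -> exists b, b * a = 1.
Hypotheses (noeR : noetherian R^o) (noeS : noetherian S^o).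
Hypothesis phi_surj : forall b, exists a, phi a = b.

Lemma restr_linear (M N : lmodType S) (f : {linear M -> N}) :
  linear (f : restr phi M -> restr phi N).
Proof. by move=> a u v; rewrite [LHS]linearP. Qed.

Definition restr_map (M N : lmodType S) (f : {linear M -> N}) :
  {linear restr phi M -> restr phi N} := to_linear (restr_linear f).

Lemma restr_fg (M : lmodType S) : fg_module M -> fg_module (restr phi M).
Proof.
move=> [p [v vE]]; exists p, v => x; split=> // _.
have [/(_ I)[c cE] _] := vE x; have /choice[a aE] j := phi_surj (c 0 j).
by exists (\row_j a j); rewrite cE; apply: eq_bigr => j _; rewrite mxE -aE.
Qed.

Lemma betti_restr_free p i : (betti epsR (restr phi 'rV[S]_p) i <=
  p * betti epsR (restr phi (S^o : lmodType S)) i)%N.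
Proof.
elim: p => [|p IHp].
  have [|F FE] := @zero_resolution R (restr phi 'rV[S]_0).
    by move=> x; rewrite [x]thinmx0.
  by rewrite mul0n; have := betti_leq_frank epsR F i; rewrite FE.
have lj : linear (fun s : S^o => row_mx (const_mx s) 0 : 'rV[S]_(1 + p)).
  move=> a s t; rewrite scale_row_mx add_row_mx scaler0 addr0.
  by congr row_mx; apply/rowP => l; rewrite !mxE.
have lh : linear (fun w : 'rV[S]_p => row_mx 0 w : 'rV[S]_(1 + p)).
  by move=> a s t; rewrite scale_row_mx add_row_mx scaler0 addr0.
rewrite mulSn; rewrite -(leq_add2l (betti epsR (restr phi (S^o : lmodType S)) i)) in IHp.
apply: leq_trans IHp.
apply: (@betti_direct_sum _ _ _ locR noeR (restr phi (S^o : lmodType S))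
  (restr phi 'rV[S]_p) (restr phi 'rV[S]_(1 + p)) (restr_map (to_linear lj))
  (restr_map (to_linear lh))).
- move=> a b /= ab0; have : row_mx (const_mx a : 'rV[S]_1) b = row_mx 0 0.
    by rewrite row_mx0 -[RHS]ab0; rewrite -[LHS]addr0 [RHS]add_row_mx addr0 add0r addr0.
  move=> /eq_row_mx[/rowP/(_ 0)]; rewrite !mxE => -> -> //.
- move=> c; exists (lsubmx (c : 'rV[S]_(1 + p)) 0 0), (rsubmx (c : 'rV[S]_(1 + p))).
  rewrite [LHS]add_row_mx addr0 add0r -[RHS](@hsubmxK _ 1 1); congr row_mx.
  by apply/rowP => l; rewrite !ord1 mxE.
- by apply: restr_fg; exact: fg_module_noetherian.
- by apply: restr_fg; apply: fg_module_noetherian; exact: noetherian_rV.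
Qed.

(** Induction on the degree along the first syzygy 0 -> K -> S^p -> M -> 0 over [S]. Over [R] the
    free term contributes at most p times the Betti number of [S], which is the summand [l = 0]; the
    syzygy contributes the others, since its Betti numbers over [S] are those of [M] shifted. *)
Lemma betti_change_of_rings (M : lmodType S) i : fg_module M ->
  (betti epsR (restr phi M) i <= \sum_(l < i.+1)
     betti epsS M l * betti epsR (restr phi (S^o : lmodType S)) (i - l))%N.
Proof.
elim: i M => [|i IHi] M fgM;
have [p [h [h_surj h_min]]] := minimal_presentation locS fgM;
pose K := lkernel h.
all: have fgK : fg_module K by apply: lkernel_fg; apply: noetherian_rV => //;
  split=> [|a u v u0 v0]; rewrite ?linear0 // linearP u0 v0 scaler0 addr0.
all: have lj : linear (@lkernel_val _ _ _ h) by [].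
all: pose j : {linear K -> 'rV_p} := to_linear lj.
all: have j_inj : injective j by exact: val_inj.
all: have hj u : h u = 0 <-> exists x, u = j x.
1,3: split=> [/eqP u0|[x ->]]; [by exists (LKernel (u0 : u \in in_lkernel h)) | exact/eqP/(valP x)].
all: have [b0 bS] := betti_syzygy locS noeS j_inj h_surj hj (fun x => h_min _ (proj2 (hj _) (ex_intro _ x erefl))) fgK.
all: have := @betti_quotient _ _ _ locR noeR (restr phi K) (restr phi 'rV[S]_p)
  (restr phi M) (restr_map j) (restr_map h) _ j_inj h_surj hj
  (restr_fg fgK) (restr_fg (fg_module_noetherian (noetherian_rV (n := p) noeS))).
  move=> /(_ 0%N) /leq_trans; apply; rewrite addn0 big_ord_recl big_ord0 addn0 b0.
  exact: betti_restr_free.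
move=> /(_ i.+1) /leq_trans; apply; rewrite big_ord_recl b0 leq_add ?betti_restr_free //.
by apply: leq_trans (IHi K fgK) _; apply: leq_sum => l _; rewrite lift0 bS subSS.
Qed.

End ChangeOfRings.

(** * Power series *)

(** [fps] has coefficients in a field; iterating over the variables requires coefficients in a
    ring. *)
Definition pseries (A : Type) : Type := nat -> A.

Section PowerSeriesRing.
Variable A : comNzRingType.
Implicit Types a b c : pseries A.

HB.instance Definition _ := GRing.Zmodule.copy (pseries A) (nat -> A).

Definition ps_one : pseries A := fun n => (n == 0)%:R.
Definition ps_mul a b : pseries A := fun n => \sum_(j < n.+1) a j * b (n - j)%N.

(** The ring laws are inherited from polynomials: a coefficient of a product depends only on
    truncations of the factors. *)
Local Definition truncate N a : {poly A} := \poly_(i < N) a i.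

Local Lemma ps_mulE N a b n :
  (n < N)%N -> ps_mul a b n = (truncate N a * truncate N b)`_n.
Proof.
move=> nN; rewrite coefM; apply: eq_bigr => j _; rewrite !coef_poly !ifT //.
  exact: leq_ltn_trans (leq_subr _ _) nN.
by apply: leq_ltn_trans nN; rewrite -ltnS.
Qed.

Local Lemma truncate_mul N a b (p : {poly A}) n : (n < N)%N ->
  (truncate N (ps_mul a b) * p)`_n = (truncate N a * truncate N b * p)`_n.
Proof.
move=> nN; rewrite !coefM; apply: eq_bigr => -[j /= jn] _; congr (_ * _).
by rewrite coef_poly (leq_trans jn nN) (ps_mulE _ _ (leq_trans jn nN)) coefM.
Qed.

Local Lemma ps_mulC : commutative ps_mul.
Proof. by move=> a b; apply/funext => n; rewrite !(@ps_mulE n.+1) // mulrC. Qed.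

Local Lemma ps_mulA : associative ps_mul.
Proof.
move=> a b c; apply/funext => n; rewrite [LHS](congr1 (@^~ n) (ps_mulC _ _)).
rewrite !(@ps_mulE n.+1) // truncate_mul //.
by rewrite [RHS]truncate_mul // mulrC mulrA.
Qed.

Local Lemma ps_mul1 : left_id ps_one ps_mul.
Proof.
move=> a; apply/funext => n; rewrite /ps_mul big_ord_recl subn0 mul1r.
by rewrite big1 ?addr0 // => j _; rewrite mul0r.
Qed.

Local Lemma ps_mulDl : left_distributive ps_mul +%R.
Proof.
move=> a b c; apply/funext => n.
transitivity (\sum_(j < n.+1) (a j + b j) * c (n - j)%N) => //.
by rewrite (eq_bigr _ (fun j _ => mulrDl _ _ _)) big_split.
Qed.

Local Lemma ps_one_neq0 : ps_one != 0.
Proof. by apply/eqP => /(congr1 (@^~ 0%N))/eqP; rewrite oner_eq0. Qed.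

HB.instance Definition _ := GRing.Zmodule_isComNzRing.Build (pseries A)
  ps_mulA ps_mulC ps_mul1 ps_mulDl ps_one_neq0.

Lemma pseriesM a b n : (a * b) n = \sum_(j < n.+1) a j * b (n - j)%N.
Proof. by []. Qed.

Lemma pseriesD a b n : (a + b) n = a n + b n.
Proof. by []. Qed.

Lemma pseriesB a b n : (a - b) n = a n - b n.
Proof. by []. Qed.

Lemma pseries_sum I (r : seq I) (P : pred I) (F : I -> pseries A) n :
  (\sum_(i <- r | P i) F i) n = \sum_(i <- r | P i) F i n.
Proof. by apply: (big_morph (fun f : pseries A => f n)). Qed.

Definition ps_mono (m : nat) (x : A) : pseries A := fun n => if n == m then x else 0.

Lemma ps_monoM m x a n : (ps_mono m x * a) n = if (n < m)%N then 0 else x * a (n - m)%N.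
Proof.
rewrite pseriesM /ps_mono; case: ltnP => mn.
  by rewrite big1 // => j _; rewrite ifF ?mul0r // ltn_eqF // (leq_ltn_trans _ mn) // -ltnS.
rewrite (bigD1 (Ordinal (mn : m < n.+1)%N)) //= eqxx big1 ?addr0 // => j.
by rewrite -val_eqE /= => /negPf->; rewrite mul0r.
Qed.

End PowerSeriesRing.

(** * Majorants and small radii *)

Section Sums.
Variable R : realFieldType.
Implicit Types u v w : nat -> R.

(** The left side sums over a triangle contained in the square on the right. *)
Lemma cauchy_product_le u v N : (forall k, 0 <= u k) -> (forall k, 0 <= v k) ->
  \sum_(k < N) \sum_(j < k.+1) u j * v (k - j)%N <=
  (\sum_(k < N) u k) * (\sum_(k < N) v k).
Proof.
move=> u0 v0.
have -> : \sum_(k < N) \sum_(j < k.+1) u j * v (k - j)%N =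
    \sum_(j < N) u j * \sum_(i < (N - j)%N) v i.
  elim: N => [|N IHN]; first by rewrite !big_ord0.
  rewrite big_ord_recr /= IHN !big_ord_recr /= subSnn subnn big_ord1 addrA.
  rewrite -big_split /=; congr (_ + _); apply: eq_bigr => j _.
  by rewrite subSn ?(ltnW (ltn_ord j)) // big_ord_recr /= mulrDr.
rewrite big_distrl /=; apply: ler_sum => j _; rewrite ler_wpM2l //.
rewrite -!(big_mkord predT) [leRHS](big_cat_nat (n := (N - j)%N)) ?leq_subr //=.
by rewrite lerDl sumr_ge0.
Qed.

(** In generating functions the recursion reads g = u + C g w. At r this yields S <= c + S / 2 for
    every partial sum S of g, so convergence is not presupposed. As [w 0 = 0], the recursion is a
    full Cauchy product. *)
Lemma recursion_bound (u w g : nat -> R) (C c e r : R) :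
  0 <= r -> 0 <= C -> C * e <= 2^-1 ->
  (forall k, 0 <= u k) -> (forall k, 0 <= w k) -> w 0 = 0 ->
  (forall N, \sum_(k < N) u k * r ^+ k <= c) ->
  (forall N, \sum_(k < N) w k * r ^+ k <= e) ->
  (forall n, g n = u n + C * \sum_(k < n) g k * w (n - k)%N) ->
  (forall n, 0 <= g n) /\ forall N, \sum_(k < N) g k * r ^+ k <= 2 * c.
Proof.
move=> r0 C0 Ce u0 w0 w00 uc we gE.
have g0 n : 0 <= g n.
  elim/ltn_ind: n => n IHn; rewrite gE addr_ge0 // mulr_ge0 // sumr_ge0 // => k _.
  by rewrite mulr_ge0 // IHn.
split=> // N; pose S := \sum_(k < N) g k * r ^+ k.
have S0 : 0 <= S by apply: sumr_ge0 => k _; rewrite mulr_ge0 ?exprn_ge0.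
suff : S <= c + 2^-1 * S by rewrite -/S; lra.
apply: le_trans (_ : _ <= c + C * (S * e)) _; last first.
  by rewrite lerD2l mulrCA mulrC ler_wpM2r.
have {1}-> : S = \sum_(k < N) u k * r ^+ k +
    C * \sum_(n < N) \sum_(k < n.+1) (g k * r ^+ k) * (w (n - k)%N * r ^+ (n - k)).
  rewrite big_distrr -big_split /=; apply: eq_bigr => n _.
  rewrite gE mulrDl -mulrA big_distrl /=; congr (_ + _ * _).
  rewrite big_ord_recr /= subnn w00 mul0r mulr0 addr0; apply: eq_bigr => k _.
  by rewrite mulrACA -exprD subnKC // ltnW.
apply: lerD => //; rewrite ler_wpM2l //.
apply: le_trans (_ : _ <= S * \sum_(k < N) w k * r ^+ k) _; last first.
  by rewrite ler_wpM2l.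
apply: (cauchy_product_le (u := fun k => g k * r ^+ k) (v := fun k => w k * r ^+ k)).
  by move=> k; rewrite mulr_ge0 ?exprn_ge0.
by move=> k; rewrite mulr_ge0 ?exprn_ge0.
Qed.

End Sums.

Lemma strong_recursion (T : Type) (x0 : T) (G : nat -> (nat -> T) -> T) :
  (forall n h h', (forall k, (k < n)%N -> h k = h' k) -> G n h = G n h') ->
  exists h, forall n, h n = G n h.
Proof.
(* [H n] is a table whose entries below n are final. *)
move=> Gext; pose H := nat_rect (fun=> nat -> T) (fun=> x0)
  (fun n h k => if k == n then G n h else h k).
have HE n k : (k < n)%N -> H n k = H k.+1 k.
  elim: n => // n IHn; rewrite ltnS leq_eqVlt => /orP[/eqP->//|kn].
  by rewrite /= ltn_eqF // IHn.
exists (fun n => H n.+1 n) => n; rewrite [LHS]/= eqxx.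
by apply: Gext => k; exact: HE.
Qed.

Section NearZero.
Variable R : realFieldType.
Implicit Types Q : {posnum R} -> Prop.

Definition near0 Q :=
  exists d : {posnum R}, forall r : {posnum R}, r%:num <= d%:num -> Q r.

Lemma near0W Q Q' : (forall r, Q r -> Q' r) -> near0 Q -> near0 Q'.
Proof. by move=> QQ' [d dQ]; exists d => r /dQ/QQ'. Qed.

Lemma near0I Q Q' : near0 Q -> near0 Q' -> near0 (fun r => Q r /\ Q' r).
Proof.
move=> [d dQ] [d' dQ']; exists (Num.min d%:num d'%:num)%:pos => r /=.
by rewrite le_min => /andP[/dQ ? /dQ' ?].
Qed.

Lemma near0_all (I : finType) (Q : I -> {posnum R} -> Prop) :
  (forall i, near0 (Q i)) -> near0 (fun r => forall i, Q i r).
Proof.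
move=> Q0; suff: near0 (fun r => forall i, i \in enum I -> Q i r).
  by apply: near0W => r Qr i; apply: Qr; rewrite mem_enum.
elim: (enum I) => [|i s IHs]; first by exists (PosNum ltr01).
apply: near0W (near0I (Q0 i) IHs) => r [Qi Qs] j.
by rewrite inE => /orP[/eqP->|/Qs].
Qed.

(** Without the term i = 0 a factor r splits off: for r <= q and i > 0, v (k + i) r^i is at most r /
    q^(k + 1) times v (k + i) q^(k + i), and the latter terms have bounded sums. *)
Lemma tail_small (v : nat -> R) (r0 : {posnum R}) M k (e : R) :
  0 < e -> (forall i, 0 <= v i) ->
  (forall N, \sum_(i < N) v i * r0%:num ^+ i <= M) ->
  near0 (fun r => forall N,
    \sum_(i < N) (if i == 0 :> nat then 0 else v (k + i)%N) * r%:num ^+ i <= e).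
Proof.
move=> e0 v0 vM; have M0 : 0 <= M by have := vM 0%N; rewrite big_ord0.
set q := r0%:num in vM; have q0 : 0 < q by rewrite /q.
have q0' : 0 <= q := ltW q0.
(* [M + 1] instead of [M] keeps the divisor [B] positive. *)
pose B := (M + 1) / q ^+ k.+1; have B0 : 0 < B by rewrite divr_gt0 ?exprn_gt0 //; lra.
have eB : 0 < e / B by rewrite divr_gt0.
have d0 : 0 < Num.min q (e / B) by rewrite lt_min q0.
exists (PosNum d0) => r /=; rewrite le_min => /andP[rq reB] N.
apply: le_trans (_ : _ <= r%:num * B) _; last first.
  by rewrite -ler_pdivlMr.
apply: le_trans (_ : _ <= r%:num / q ^+ k.+1 * \sum_(i < k + N) v i * q ^+ i) _; last first.
  rewrite mulrAC -mulrA ler_wpM2l // ler_wpM2r ?invr_ge0 ?exprn_ge0 ?ltW //.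
  by apply: le_lt_trans (vM _) _; rewrite ltrDl.
rewrite big_split_ord /= mulrDr ler_wpDl //.
  by rewrite mulr_ge0 ?divr_ge0 ?exprn_ge0 ?sumr_ge0 // => i _; rewrite mulr_ge0 ?exprn_ge0 // ltW.
rewrite big_distrr /=; apply: ler_sum => -[[|i] iN] _ /=.
  by rewrite mul0r mulr_ge0 ?divr_ge0 ?mulr_ge0 ?exprn_ge0.
rewrite [leRHS](_ : _ = v (k + i.+1)%N * (r%:num * q ^+ i)); last first.
  by rewrite addnS -addSn exprD; field; rewrite gt_eqF ?exprn_gt0.
by rewrite exprS ler_wpM2l // ler_wpM2l // lerXn2r ?nnegrE.
Qed.

End NearZero.

(** * Gauges *)

(* [nb rho a c] reads "the norm of a on the polydisc of polyradius rho is at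
   most c", and [small Q] "Q holds for all sufficiently small rho". *)
Record gauge (R : realFieldType) (A : comNzRingType) := Gauge {
  polyradius : Type;
  rle : polyradius -> polyradius -> Prop;
  small : (polyradius -> Prop) -> Prop;
  nb : polyradius -> A -> R -> Prop;
  nb_ge0 : forall rho a c, nb rho a c -> 0 <= c;
  nb_le : forall rho a c d, nb rho a c -> c <= d -> nb rho a d;
  nb0 : forall rho, nb rho 0 0;
  nb1 : forall rho, nb rho 1 1;
  nbN : forall rho a c, nb rho a c -> nb rho (- a) c;
  nbD : forall rho a b c d, nb rho a c -> nb rho b d -> nb rho (a + b) (c + d);
  nbM : forall rho a b c d, nb rho a c -> nb rho b d -> nb rho (a * b) (c * d);
  nb_rle : forall rho rho' a c, rle rho' rho -> nb rho a c -> nb rho' a c;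
  small_rle : forall rho, small (rle^~ rho);
  smallW : forall Q Q' : polyradius -> Prop,
    (forall rho, Q rho -> Q' rho) -> small Q -> small Q';
  smallI : forall Q Q', small Q -> small Q' -> small (fun rho => Q rho /\ Q' rho);
  smallT : forall Q : polyradius -> Prop, (forall rho, Q rho) -> small Q;
  small_ex : forall Q, small Q -> exists rho, Q rho
}.
Arguments small {R A} g.
Arguments nb {R A} g.
Arguments rle {R A} g.

Section Gauge.
Variables (R : realFieldType) (A : comNzRingType) (g : gauge R A).
Local Notation polyradius := (polyradius g).
Local Notation nb := (nb g).
Local Notation small := (small g).

Lemma small_all (I : finType) (Q : I -> polyradius -> Prop) :
  (forall i, small (Q i)) -> small (fun r => forall i, Q i r).
Proof.
move=> Q0; suff: small (fun r => forall i, i \in enum I -> Q i r).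
  by apply: smallW => r Qr i; apply: Qr; rewrite mem_enum.
elim: (enum I) => [|i s IHs]; first exact: smallT.
apply: smallW (smallI (Q0 i) IHs) => r [Qi Qs] j.
by rewrite inE => /orP[/eqP->|/Qs].
Qed.

Lemma nb_sum I (r : seq I) (P : pred I) rho (F : I -> A) (c : I -> R) :
  (forall i, P i -> nb rho (F i) (c i)) ->
  nb rho (\sum_(i <- r | P i) F i) (\sum_(i <- r | P i) c i).
Proof.
by move=> Fc; apply: (big_ind2 (nb rho)) => //; [exact: nb0 | move=> *; apply: nbD].
Qed.

Lemma nbB rho a b c d : nb rho a c -> nb rho b d -> nb rho (a - b) (c + d).
Proof. by move=> ac bd; apply: nbD => //; apply: nbN. Qed.

Definition convergent a := small (fun rho => exists c, nb rho a c).

Lemma convergentW rho a c : nb rho a c -> convergent a.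
Proof.
by move=> ac; apply: smallW (small_rle rho) => r rr; exists c; apply: nb_rle rr ac.
Qed.

Lemma convergentB a b : convergent a -> convergent b -> convergent (a - b).
Proof.
move=> ca cb; apply: smallW (smallI ca cb) => r [[c ac] [d bd]].
by exists (c + d); apply: nbB.
Qed.

Lemma convergentM a b : convergent a -> convergent b -> convergent (a * b).
Proof.
move=> ca cb; apply: smallW (smallI ca cb) => r [[c ac] [d bd]].
by exists (c * d); apply: nbM.
Qed.

Lemma convergent1 : convergent 1.
Proof. by apply: smallT => rho; exists 1; apply: nb1. Qed.

(** An ideal of the ring of convergent elements, kept as a predicate on the ambient ring of formal
    series so that this subring need not become a type. *)
Record convergent_ideal (I : A -> Prop) : Prop := ConvergentIdeal {
  ideal_convergent : forall a, I a -> convergent a;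
  ideal0 : I 0;
  idealD : forall a b, I a -> I b -> I (a + b);
  idealM : forall c a, convergent c -> I a -> I (c * a)
}.

Lemma ideal_sum (I : A -> Prop) T (r : seq T) (P : pred T) F :
  convergent_ideal I -> (forall i, P i -> I (F i)) -> I (\sum_(i <- r | P i) F i).
Proof. by case=> _ I0 ID _ IF; elim/big_ind: _. Qed.

Lemma idealB (I : A -> Prop) a b : convergent_ideal I -> I a -> I b -> I (a - b).
Proof.
case=> _ I0 ID IM Ia Ib; apply: ID => //; rewrite -mulN1r; apply: IM => //.
by rewrite -sub0r; apply: convergentB convergent1; rewrite -(subrr 1); apply: convergentB convergent1; exact: convergent1.
Qed.

(** The classical notion of a privileged polydisc. [C] may depend on [rho], but not on the
    dividend. *)
Definition privileged (I : A -> Prop) (J : finType) (f : J -> A) rho :=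
  exists2 C : R, 0 <= C & forall a c, I a -> nb rho a c ->
    exists2 h : J -> A, forall j, nb rho (h j) (C * c) & a = \sum_j h j * f j.

(* The bounds on the quotients are what makes the induction on the number of
   variables work. *)
Definition strongly_noetherian := forall I, convergent_ideal I ->
  exists (J : finType) (f : J -> A), (forall j, I (f j)) /\ small (privileged I f).

Lemma strongly_noetherian_fg I : strongly_noetherian -> convergent_ideal I ->
  exists (J : finType) (f : J -> A), (forall j, I (f j)) /\
    forall a, I a -> exists2 h : J -> A, forall j, convergent (h j) &
      a = \sum_j h j * f j.
Proof.
move=> sn II; have [J [f [If fP]]] := sn I II.
exists J, f; split=> // a Ia.
have [rho [[C _ CE] [c ac]]] := small_ex (smallI fP (ideal_convergent II Ia)).
by have [h hC ->] := CE a c Ia ac; exists h => // j; apply: convergentW (hC j).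
Qed.

End Gauge.
Arguments privileged {R A} g I {J} f rho.

Section PowerSeriesGauge.
Variables (R : realFieldType) (A : comNzRingType) (g : gauge R A).
Local Notation polyradius' := (polyradius g * {posnum R})%type.

Definition ps_rle (s r : polyradius') := rle g s.1 r.1 /\ s.2%:num <= r.2%:num.
(* The radius in the last variable is chosen after, and depending on, the other
   radii. *)
Definition ps_small (Q : polyradius' -> Prop) := small g (fun rho => near0 (fun r => Q (rho, r))).
(** The weighted l1 norm. Stating it through a majorant [u] avoids infinite sums, and fits
    coefficient norms that are themselves only given by upper bounds. *)
Definition ps_nb (r : polyradius') (f : pseries A) (c : R) :=
  exists2 u : nat -> R, forall k, nb g r.1 (f k) (u k) &
    forall N, \sum_(k < N) u k * r.2%:num ^+ k <= c.

Local Lemma ps_nb_ge0 r f c : ps_nb r f c -> 0 <= c.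
Proof. by move=> [u _ /(_ 0%N)]; rewrite big_ord0. Qed.

Local Lemma ps_nb_le r f c d : ps_nb r f c -> c <= d -> ps_nb r f d.
Proof. by move=> [u fu uc] cd; exists u => // N; apply: le_trans (uc N) cd. Qed.

Local Lemma ps_nb0 r : ps_nb r 0 0.
Proof.
exists (fun=> 0) => [k|N]; first exact: nb0.
by rewrite big1 // => k _; rewrite mul0r.
Qed.

Lemma ps_nb_mono m r a c : nb g r.1 a c -> ps_nb r (ps_mono m a) (c * r.2%:num ^+ m).
Proof.
move=> ac; exists (fun k => if k == m then c else 0) => [k|N].
  by rewrite /ps_mono; case: ifP => _ //; apply: nb0.
have c0 := nb_ge0 ac; case: (ltnP m N) => [mN|Nm]; last first.
  rewrite big1 ?mulr_ge0 ?exprn_ge0 // => k _; rewrite ifF ?mul0r //.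
  by rewrite ltn_eqF // (leq_trans _ Nm).
rewrite (bigD1 (Ordinal mN)) //= eqxx big1 ?addr0 // => k.
by rewrite -val_eqE /= => /negPf->; rewrite mul0r.
Qed.

Local Lemma ps_nb1 r : ps_nb r 1 1.
Proof.
have := @ps_nb_mono 0 r 1 1 (nb1 _); rewrite mulr1; congr (ps_nb _ _ _).
by apply/funext => -[].
Qed.

Local Lemma ps_nbN r f c : ps_nb r f c -> ps_nb r (- f) c.
Proof. by move=> [u fu uc]; exists u => // k; apply: nbN. Qed.

Local Lemma ps_nbD r f h c d : ps_nb r f c -> ps_nb r h d -> ps_nb r (f + h) (c + d).
Proof.
move=> [u fu uc] [v hv vd]; exists (fun k => u k + v k) => [k|N]; first exact: nbD.
under eq_bigr do rewrite mulrDl.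
by rewrite big_split lerD.
Qed.

Local Lemma ps_nbM r f h c d : ps_nb r f c -> ps_nb r h d -> ps_nb r (f * h) (c * d).
Proof.
move=> [u fu uc] [v hv vd]; exists (fun k => \sum_(j < k.+1) u j * v (k - j)%N) => [k|N].
  by rewrite pseriesM; apply: nb_sum => j _; apply: nbM.
have u0 k : 0 <= u k := nb_ge0 (fu k); have v0 k : 0 <= v k := nb_ge0 (hv k).
apply: (@le_trans _ _ ((\sum_(k < N) u k * r.2%:num ^+ k) * (\sum_(k < N) v k * r.2%:num ^+ k))).
  rewrite (le_trans _ (cauchy_product_le (u := fun k => u k * r.2%:num ^+ k)
    (v := fun k => v k * r.2%:num ^+ k) _ _ _)) //; last 2 first.
  - by move=> k; rewrite mulr_ge0 ?exprn_ge0.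
  - by move=> k; rewrite mulr_ge0 ?exprn_ge0.
  apply: ler_sum => k _; rewrite big_distrl; apply: ler_sum => j _ /=.
  by rewrite mulrACA -exprD subnKC // -ltnS.
by rewrite ler_pM ?sumr_ge0 // => k _; rewrite mulr_ge0 ?exprn_ge0.
Qed.

Local Lemma ps_nb_rle r s f c : ps_rle s r -> ps_nb r f c -> ps_nb s f c.
Proof.
move=> [le1 le2] [u fu uc]; exists u => [k|N]; first exact: nb_rle (fu k).
apply: le_trans (uc N); apply: ler_sum => k _.
by rewrite ler_wpM2l ?(nb_ge0 (fu k)) // lerXn2r ?nnegrE.
Qed.

Local Lemma ps_small_rle r : ps_small (ps_rle^~ r).
Proof. by apply: smallW (small_rle r.1) => s sr; exists r.2. Qed.

Local Lemma ps_smallW Q Q' : (forall r, Q r -> Q' r) -> ps_small Q -> ps_small Q'.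
Proof. by move=> QQ'; apply: smallW => r; apply: near0W => s; apply: QQ'. Qed.

Local Lemma ps_smallI Q Q' :
  ps_small Q -> ps_small Q' -> ps_small (fun r => Q r /\ Q' r).
Proof.
by move=> sQ sQ'; apply: smallW (smallI sQ sQ') => r [nQ nQ']; apply: near0I.
Qed.

Local Lemma ps_smallT Q : (forall r, Q r) -> ps_small Q.
Proof. by move=> QT; apply: smallT => r; exists (PosNum ltr01). Qed.

Local Lemma ps_small_ex Q : ps_small Q -> exists r, Q r.
Proof. by move=> /small_ex[r [d dQ]]; exists (r, d); apply: dQ. Qed.

Definition ps_gauge : gauge R (pseries A) := Gauge ps_nb_ge0 ps_nb_le ps_nb0 ps_nb1
  ps_nbN ps_nbD ps_nbM ps_nb_rle ps_small_rle ps_smallW ps_smallI ps_smallT ps_small_ex.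

Lemma ps_convergentE f : convergent ps_gauge f =
  small g (fun rho => near0 (fun r => exists c, ps_nb (rho, r) f c)).
Proof. by []. Qed.

Lemma ps_convergent_coef f k : convergent ps_gauge f -> convergent g (f k).
Proof.
rewrite ps_convergentE; apply: smallW => rho [d dQ]; have [c [u fu _]] := dQ d (lexx _).
by exists (u k).
Qed.

Lemma ps_convergent_mono m a : convergent g a -> convergent ps_gauge (ps_mono m a).
Proof.
rewrite ps_convergentE; apply: smallW => rho [c ac]; exists (PosNum ltr01) => r _.
by exists (c * r%:num ^+ m); exact: ps_nb_mono.
Qed.

(** The coefficients of the inverse obey a recursion majorized by that of [recursion_bound], where w
    bounds the nonconstant coefficients of [f] and C bounds [b]. *)
Lemma ps_convergent_inv f b : convergent ps_gauge f -> convergent g b ->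
  b * f 0 = 1 -> exists2 h, convergent ps_gauge h & h * f = 1.
Proof.
rewrite ps_convergentE => cf cb bf;
have [|h hE] := @strong_recursion A 0
  (fun n h => if n is 0 then b else - b * \sum_(k < n) h k * f (n - k)%N).
  case=> // n h h' hh'; congr (_ * _); apply: eq_bigr => k _.
  by rewrite hh'.
exists h; last first.
  apply/funext => n; rewrite pseriesM big_ord_recr /= subnn hE.
  case: n => [|n]; first by rewrite big_ord0 add0r.
  by rewrite mulrAC mulNr bf mulN1r subrr.
have [rho [[C bC] [d dQ]]] := small_ex (smallI cb cf).
have [M [v fv vM]] := dQ d (lexx _); rewrite /= in fv vM.
have v0 k : 0 <= v k := nb_ge0 (fv k); have C0 := nb_ge0 bC.
(* Chosen so that [C * e <= 2^-1]; the added 1 covers [C = 0]. *)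
pose e := 2^-1 / (C + 1).
have e0 : 0 < e by rewrite divr_gt0 // ltr_wpDl.
have Ce : C * e <= 2^-1.
  rewrite /e mulrCA ler_piMr // ler_pdivrMr ?mul1r ?lerDl //; lra.
have [r rE] := tail_small 0 e0 v0 vM.
have {}rE := rE r (lexx _).
pose w i := if i == 0%N :> nat then 0 else v i.
have w0 k : 0 <= w k by rewrite /w; case: ifP.
pose u n : R := if n is 0 then C else 0.
have u0 n : 0 <= u n by case: n.
have uC N : \sum_(k < N) u k * r%:num ^+ k <= C.
  case: N => [|N]; first by rewrite big_ord0.
  by rewrite big_ord_recl mulr1 big1 ?addr0 // => k _; rewrite mul0r.
have [|gm gmE] := @strong_recursion R 0
  (fun n g => u n + C * \sum_(k < n) g k * w (n - k)%N).
  by move=> n h' h'' hh; congr (_ + _ * _); apply: eq_bigr => k _; rewrite hh.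
have [gm0 gmC] := recursion_bound (ltW (gt0 r)) C0 Ce u0 w0 erefl uC rE gmE.
apply: (@convergentW _ _ ps_gauge (rho, r) _ (2 * C)); exists gm => //= n.
elim/ltn_ind: n => n IHn; rewrite hE gmE; case: n IHn => [|n] IHn.
  by rewrite big_ord0 mulr0 addr0.
rewrite add0r; apply: nbM; first exact: nbN.
apply: nb_sum => k _; apply: nbM; first exact: IHn.
by rewrite /w ifF //; apply/negbTE; rewrite subn_eq0 -ltnNge.
Qed.

End PowerSeriesGauge.

(** * The basis theorem *)

Section StronglyNoetherianPowerSeries.
Variables (R : realFieldType) (A : comNzRingType) (g : gauge R A).
Hypothesis sn : strongly_noetherian g.
Local Notation pg := (ps_gauge g).

Section Ideal.
Variable I : pseries A -> Prop.
Hypothesis II : convergent_ideal pg I.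

(** Power series have no top term, so lowest coefficients in the last variable take the place of the
    leading coefficients in Hilbert's argument. *)
Definition leading k (b : A) :=
  exists f, [/\ I f, forall i, (i < k)%N -> f i = 0 & f k = b].

Lemma leading_ideal k : convergent_ideal g (leading k).
Proof.
split.
- by move=> _ [f [If _ <-]]; apply/ps_convergent_coef/(ideal_convergent II).
- by exists 0; split=> //; exact: ideal0 II.
- move=> _ _ [f [If f0 <-]] [h [Ih h0 <-]]; exists (f + h); split=> //.
    exact: (idealD II).
  by move=> i ik; rewrite pseriesD f0 // h0 // addr0.
move=> c _ cc [f [If f0 <-]]; exists (ps_mono 0 c * f); split.
- by apply: (idealM II) => //; apply: ps_convergent_mono.
- by move=> i ik; rewrite ps_monoM subn0 f0 // mulr0.
by rewrite ps_monoM subn0.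
Qed.

Lemma leadingD m k b : leading k b -> leading (m + k)%N b.
Proof.
move=> [f [If f0 <-]]; exists (ps_mono m 1 * f); split.
- by apply: (idealM II) => //; apply/ps_convergent_mono/convergent1.
- move=> i im; rewrite ps_monoM; case: ltnP => // mi; rewrite f0 ?mulr0 //.
  by rewrite ltn_subLR.
by rewrite ps_monoM ltnNge leq_addr mul1r addKn.
Qed.

(** The union of the increasing ideals [leading k] is finitely generated; K is the largest degree in
    which a chosen generator occurs. *)
Lemma leading_stable : exists K, forall k b, leading k b -> leading K b.
Proof.
have Linf : convergent_ideal g (fun b => exists k, leading k b).
  split.
  - by move=> b [k]; apply: (ideal_convergent (leading_ideal k)).
  - by exists 0; apply: ideal0 (leading_ideal 0).
  - move=> a b [k ka] [l lb]; exists (l + k)%N; apply: (idealD (leading_ideal _)).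
      exact: leadingD.
    by rewrite addnC; apply: leadingD.
  by move=> c a cc [k ka]; exists k; apply: (idealM (leading_ideal k)).
have [J [f [/choice[k kf] fP]]] := strongly_noetherian_fg sn Linf.
exists (\max_j k j)%N => l b lb.
have [h hc ->] := fP b (ex_intro _ l lb).
apply: ideal_sum => [|j _]; first exact: leading_ideal.
apply: (idealM (leading_ideal _)) => //.
have := leadingD (\max_i k i - k j)%N (kf j); rewrite subnK //.
exact: leq_bigmax.
Qed.

Section Division.
Variables (K : nat) (J : 'I_K.+1 -> finType).
Local Notation JJ := {k : 'I_K.+1 & J k}.
Variables (F : JJ -> pseries A) (rho : polyradius g) (C : R).
Hypothesis stable : forall k b, leading k b -> leading K b.
Hypothesis C0 : 0 <= C.
Hypothesis IF : forall p, I (F p).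
Hypothesis F0 : forall (p : JJ) i, (i < tag p)%N -> F p i = 0.
Hypothesis FE : forall k : 'I_K.+1, forall b c, leading k b -> nb g rho b c ->
  exists2 h : JJ -> A, forall p, nb g rho (h p) (C * c) &
    b = \sum_(p : JJ | tag p == k) h p * F p (tag p).

(** The degree whose generators are used to divide in degree [l]: from K on, the ideals of lowest
    coefficients no longer grow. *)
Let kap l : 'I_K.+1 := inord (minn l K).

Let kapE l : kap l = minn l K :> nat.
Proof. by rewrite inordK // ltnS geq_minr. Qed.

Let leading_kap l b : leading l b -> leading (kap l) b.
Proof.
by rewrite kapE; case: (leqP l K) => [lK|Kl] lb //; apply: stable lb.
Qed.

Variables (v : JJ -> nat -> R).
Hypothesis Fv : forall p i, nb g rho (F p i) (v p i).

(** How much one step disturbs the coefficient i places further on. The entry at 0 vanishes because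
    the lowest coefficient is cancelled exactly. *)
Let w i := if i == 0%N :> nat then 0 else \sum_(p : JJ) v p (tag p + i)%N.

Let v0 p i : 0 <= v p i. Proof. exact: nb_ge0 (Fv p i). Qed.

Let w0 i : 0 <= w i.
Proof. by rewrite /w; case: ifP => // _; apply: sumr_ge0. Qed.

Variables (r : {posnum R}) (e : R).
Hypothesis Ce : C * e <= 2^-1.
Hypothesis we : forall N, \sum_(i < N) w i * r%:num ^+ i <= e.

Variables (f : pseries A) (c : R).
Hypotheses (If : I f) (fc : nb pg (rho, r) f c).

(** Step l cancels the coefficient of degree l of the remainder by a bounded division in
    [leading (kap l)]. The bounds [bet] of the successive dividends satisfy the recursion of
    [recursion_bound], hence have weighted sums at most 2c. Generator p enters with degree [tag p],
    which costs r^(- tag p); the sum over all k makes the bound independent of p. *)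
Lemma division : exists2 G : JJ -> pseries A,
  forall p, nb pg (rho, r) (G p) (C * \sum_(k < K.+1) r%:num ^- k * (2 * c)) &
  f = \sum_p G p * F p.
Proof.
(* The division becomes a total function of degree, dividend and bound, with junk value 0, so that
   the remainders can be defined before their properties are known. *)
have /choice[D DE] (x : 'I_K.+1 * A * R) : exists h : JJ -> A,
    leading x.1.1 x.1.2 -> nb g rho x.1.2 x.2 ->
    (forall p, nb g rho (h p) (C * x.2)) /\
    x.1.2 = \sum_(p : JJ | tag p == x.1.1) h p * F p (tag p).
  case: (pselect (leading x.1.1 x.1.2 /\ nb g rho x.1.2 x.2)) => [[lb bc]|nP].
    by have [h h1 h2] := FE lb bc; exists h.
  by exists (fun=> 0) => lb bc; case: nP.
have [u fu uc] := fc; rewrite /= in fu uc.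
have u0 k : 0 <= u k := nb_ge0 (fu k).
(* [bet l] bounds the norm of the coefficient divided at step l, which is the
   degree l coefficient of the l-th remainder [fs l]. *)
have [|bet betE] := @strong_recursion R 0
  (fun n h => u n + C * \sum_(k < n) h k * w (n - k)%N).
  by move=> n h' h'' hh; congr (_ + _ * _); apply: eq_bigr => k _; rewrite hh.
have [bet0 betc] := recursion_bound (ltW (gt0 r)) C0 Ce u0 w0 erefl uc we betE.
pose quo l (h : pseries A) := D (kap l, h l, bet l).
pose T l h := \sum_(p : JJ | tag p == kap l) ps_mono (l - tag p)%N (quo l h p) * F p.
pose fs := nat_rect (fun=> pseries A) f (fun l h => h - T l h).
have fsS l : fs l.+1 = fs l - T l (fs l) by [].
(* The bound at stage l is the recursion for [bet] cut after l terms; at [i = l] it is [bet l]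
   itself. *)
have inv l : [/\ I (fs l), forall i, (i < l)%N -> fs l i = 0 &
    forall i, (l <= i)%N -> nb g rho (fs l i) (u i + C * \sum_(k < l) bet k * w (i - k)%N)].
  elim: l => [|l [Il lt_l ge_l]].
    by split=> // i _; rewrite big_ord0 mulr0 addr0.
  have lead_l : leading l (fs l l) by exists (fs l).
  have nb_l : nb g rho (fs l l) (bet l) by rewrite betE; apply: ge_l.
  have [quo_nb quoE] := DE (kap l, fs l l, bet l) (leading_kap lead_l) nb_l.
  rewrite /= -/(quo l (fs l)) in quo_nb quoE.
  have kapl (p : JJ) : tag p == kap l -> (tag p <= l)%N.
    by move=> /eqP->; rewrite kapE geq_minl.
  have TE i : T l (fs l) i = if (i < l)%N then 0 else
      \sum_(p : JJ | tag p == kap l) quo l (fs l) p * F p (tag p + (i - l))%N.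
    rewrite /T pseries_sum; case: ltnP => il.
      rewrite big1 // => p /kapl pl; rewrite ps_monoM; case: ltnP => // ilp.
      by rewrite F0 ?mulr0 //; lia.
    apply: eq_bigr => p /kapl pl; rewrite ps_monoM ifF; last by lia.
    by congr (_ * F p _); lia.
  split; rewrite fsS.
  - apply: (idealB II) => //; rewrite /T; apply: (ideal_sum _ II) => p _; apply: (idealM II) => //.
    by apply: ps_convergent_mono; apply: convergentW (quo_nb p).
  - move=> i; rewrite ltnS leq_eqVlt pseriesB TE => /orP[/eqP->|il].
      rewrite ltnn subnn [X in X - _]quoE; apply/eqP; rewrite subr_eq0; apply/eqP.
      by apply: eq_bigr => p _; rewrite addn0.
    by rewrite il lt_l // subr0.
  move=> i li; rewrite pseriesB TE ltnNge (ltnW li) /= big_ord_recr /= mulrDr addrA.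
  apply: nbB; first exact/ge_l/ltnW.
  apply: (@nb_le _ _ _ _ _ (\sum_(p : JJ | tag p == kap l) C * bet l * v p (tag p + (i - l))%N)).
    by apply: nb_sum => p _; apply: nbM.
  rewrite -big_distrr /= mulrA ler_wpM2l ?mulr_ge0 //.
  rewrite /w ifF; last by apply/negbTE; rewrite subn_eq0 -ltnNge.
  by rewrite [leRHS](bigID (fun p : JJ => tag p == kap l)) /= lerDl sumr_ge0.
have quo_nb l p : nb g rho (quo l (fs l) p) (C * bet l).
  have [Il lt_l ge_l] := inv l.
  have lead_l : leading l (fs l l) by exists (fs l).
  have nb_l : nb g rho (fs l l) (bet l) by rewrite betE; apply: ge_l.
  by have [qn _] := DE (kap l, fs l l, bet l) (leading_kap lead_l) nb_l; exact: qn.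
(* Generator p receives its coefficient of degree s at step [tag p + s], provided that step uses p.
   If [tag p < K] this happens only for [s = 0]. *)
pose G (p : JJ) : pseries A := fun s =>
  if tag p == kap (tag p + s) then quo (tag p + s)%N (fs (tag p + s)%N) p else 0.
(* The quotients collected in the first L steps, for which the division identity is a finite
   induction. *)
pose GL L (p : JJ) : pseries A := fun s => if (tag p + s < L)%N then G p s else 0.
have GLE L : f - fs L = \sum_p GL L p * F p.
  elim: L => [|L IHL].
    rewrite [fs 0]/fs /= subrr big1 // => p _.
    by rewrite (_ : GL 0 p = 0) ?mul0r //; apply/funext => s.
  rewrite fsS opprB addrA addrAC IHL addrC /T big_mkcond -big_split /=.
  apply: eq_bigr => p _.
  rewrite (_ : GL L.+1 p = GL L p + if tag p == kap L then ps_mono (L - tag p)%N (quo L (fs L) p) else 0).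
    by rewrite mulrDl addrC; case: ifP; rewrite // mul0r.
  apply/funext => s; rewrite pseriesD /GL ltnS leq_eqVlt.
  have [sL|sL] := eqVneq (tag p + s)%N L.
    rewrite sL ltnn /= add0r /G sL; case: ifP => // _.
    by rewrite /ps_mono -sL addKn eqxx.
  rewrite /= -[LHS]addr0; congr (_ + _); case: ifP => [/eqP pk|//].
  rewrite /ps_mono ifF //; apply: contra_neqF sL => /eqP->.
  by rewrite subnKC // pk kapE geq_minl.
exists G => [p|]; last first.
  (* After this many steps the remainder vanishes in degree i, and since [tag p <= K] the quotients
     are final up to degree i. *)
  apply/funext => i; pose L := (K + i)%N.+1.
  have /(congr1 (fun h : pseries A => h i)) := GLE L.
  rewrite pseriesB (_ : fs L i = 0) ?subr0; last first.
    by have [_ -> //] := inv L; rewrite ltnS leq_addl.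
  move=> ->; rewrite !pseries_sum; apply: eq_bigr => p _.
  rewrite !pseriesM; apply: eq_bigr => j _; congr (_ * _); rewrite /GL ifT //.
  rewrite ltnS leq_add // -ltnS //.
exists (fun s => C * bet (tag p + s)%N) => [s|N] /=.
  rewrite /G; case: ifP => _ //; apply: nb_le (nb0 _) _.
  by rewrite mulr_ge0.
under eq_bigr do rewrite -mulrA.
rewrite -big_distrr ler_wpM2l //=.
have c0 : 0 <= c := nb_ge0 fc.
(* Only the summand r^(- tag p) is kept. *)
rewrite (bigD1 (tag p)) //= ler_wpDr //.
  by rewrite sumr_ge0 // => k _; rewrite mulr_ge0 ?invr_ge0 ?exprn_ge0 ?mulr_ge0.
rewrite mulrC ler_pdivlMr ?exprn_gt0 //.
apply: le_trans (betc (tag p + N)%N).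
rewrite big_split_ord /= ler_wpDl ?sumr_ge0 // => [k _|].
  by rewrite mulr_ge0 ?exprn_ge0.
rewrite big_distrl /=; apply: ler_sum => s _.
by rewrite -mulrA -exprD addnC.
Qed.

End Division.

(** The generators are lifts to [I] of generators of [leading k] for all k <= K. First [rho] is
    taken privileged for these finitely many ideals, with all lifts convergent; then r is made small
    in terms of the resulting constants. *)
Lemma ideal_strongly_noetherian :
  exists (J : finType) (f : J -> pseries A), (forall j, I (f j)) /\
    small pg (privileged pg I f).
Proof.
have [K stable] := leading_stable.
have /choice[J /= JE] (k : 'I_K.+1) : exists J : finType, exists f : J -> pseries A,
    (forall j, I (f j) /\ forall i, (i < k)%N -> f j i = 0) /\
    small g (privileged g (leading k) (fun j => f j k)).
  have [J [b [/choice[f fE] bP]]] := sn (leading_ideal k).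
  exists J, f; split=> [j|]; first by have [] := fE j.
  rewrite (_ : (fun j => f j k) = b) //; apply/funext => j.
  by have [] := fE j.
have F k := cid (JE k).
pose f (p : {k : 'I_K.+1 & J k}) := sval (F (tag p)) (tagged p).
have If p : I (f p) by have [/(_ (tagged p))[]] := svalP (F (tag p)).
have f0 (p : {k : 'I_K.+1 & J k}) i : (i < tag p)%N -> f p i = 0.
  by have [/(_ (tagged p))[_ h] _] := svalP (F (tag p)); exact: h.
exists {k : 'I_K.+1 & J k}, f; split=> //.
have fconv (p : {k : 'I_K.+1 & J k}) := ideal_convergent II (If p).
apply: smallW (smallI (small_all (fun k => (svalP (F k)).2)) (small_all fconv)).
move=> rho [Prho conv_f].
have /choice[C CE] (k : 'I_K.+1) : exists C, 0 <= C /\ forall b c, leading k b -> nb g rho b c ->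
    exists2 h : J k -> A, forall j, nb g rho (h j) (C * c) &
      b = \sum_j h j * sval (F k) j k.
  by have [C C0 CE] := Prho k; exists C.
have C0 k : 0 <= C k by have [] := CE k.
pose S := \sum_k C k; have S0 : 0 <= S by apply: sumr_ge0.
have CS k : C k <= S by rewrite /S (bigD1 k) //= lerDl sumr_ge0.
have /choice[dv dvE] (p : {k : 'I_K.+1 & J k}) : exists dv : {posnum R} * (nat -> R),
    (forall i, nb g rho (f p i) (dv.2 i)) /\
    exists M, forall N, \sum_(i < N) dv.2 i * dv.1%:num ^+ i <= M.
  have [d dP] := conv_f; have [M [v fv vM]] := dP d (lexx _) p.
  by exists (d, v); split=> //; exists M.
pose v p := (dv p).2.
have fv p i : nb g rho (f p i) (v p i) by have [] := dvE p.
have v0 p i : 0 <= v p i := nb_ge0 (fv p i).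
pose e := 2^-1 / (S + 1); have e0 : 0 < e by rewrite divr_gt0 // ltr_wpDl.
have Se : S * e <= 2^-1.
  by rewrite /e mulrCA ler_piMr // ler_pdivrMr ?mul1r ?lerDl //; lra.
pose m := #|{: {k : 'I_K.+1 & J k}}|.
(* Each of the m generators gets an equal share of the admissible total [e]; the successor covers m
   = 0. *)
have em0 : 0 < e / m.+1%:R by rewrite divr_gt0.
have vtail (p : {k : 'I_K.+1 & J k}) : near0 (fun r : {posnum R} => forall N,
    \sum_(i < N) (if i == 0%N :> nat then 0 else v p (tag p + i)%N) * r%:num ^+ i <= e / m.+1%:R).
  by have [_ [M vM]] := dvE p; apply (tail_small (tag p) em0 (v0 p) vM).
apply: near0W (near0_all vtail) => r rE.
exists (S * \sum_(k < K.+1) r%:num ^- k * 2) => [|a c Ia ac].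
  by rewrite mulr_ge0 ?sumr_ge0 // => k _; rewrite mulr_ge0 ?invr_ge0 ?exprn_ge0.
have [|N|G GP ->] := @division K J f rho S stable S0 If f0 _ v fv r e Se _ a c Ia ac.
- move=> k b d lb bd; have [_ /(_ b d lb bd)[h hd bE]] := CE k.
  have d0 := nb_ge0 bd.
  (* Quotients for degree k are extended by 0 to the generators of other degrees. *)
  exists (untag 0 h) => [p|].
    have [pk|pk] := eqVneq (tag p) k.
      by rewrite (untagE _ _ pk); apply: nb_le (hd _) _; rewrite ler_wpM2r.
    by rewrite untag_dflt //; apply: nb_le (nb0 _) _; rewrite mulr_ge0.
  transitivity (\sum_(i | i == k) \sum_(j : J i)
      untag 0 h (Tagged J j) * f (Tagged J j) i).
    rewrite big_pred1_eq bE; apply: eq_bigr => j _.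
    by rewrite (@untagE _ _ _ 0 k h (Tagged J j) erefl).
  by rewrite sig_big_dep; apply: eq_big => [p|[i j]//]; rewrite andbT.
- apply: le_trans (_ : \sum_(p : {k : 'I_K.+1 & J k}) e / m.+1%:R <= _).
    apply: le_trans (ler_sum _ (fun p _ => rE p N)).
    rewrite exchange_big /=; apply: ler_sum => i _.
    by case: eqP => [_|_]; rewrite -big_distrl /= // big1.
  rewrite sumr_const -[_ *+ #|_|]mulr_natr -mulrA ler_piMr ?(ltW e0) //.
  by rewrite mulrC ler_pdivrMr // mul1r ler_nat ltnW.
exists G => // p; apply: nb_le (GP p) _.
rewrite le_eqVlt; apply/orP; left; apply/eqP; rewrite -mulrA; congr (_ * _).
by rewrite big_distrl; apply: eq_bigr => k _; rewrite /= mulrA.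
Qed.

End Ideal.

Lemma strongly_noetherian_pseries : strongly_noetherian pg.
Proof. by move=> I II; exact: ideal_strongly_noetherian. Qed.

End StronglyNoetherianPowerSeries.

(** * Zero variables, and iteration to several variables *)

Section ValuedField.
Variables (R : realFieldType) (K : fieldType) (abs : K -> R).
Hypotheses (abs_ge0 : forall a, 0 <= abs a) (abs0 : abs 0 = 0) (abs1 : abs 1 = 1).
Hypothesis absN : forall a, abs (- a) = abs a.
Hypothesis absD : forall a b, abs (a + b) <= abs a + abs b.
Hypothesis absM : forall a b, abs (a * b) = abs a * abs b.

Definition field_gauge : gauge R K.
Proof.
apply: (@Gauge R K unit (fun _ _ => True) (fun Q => Q tt) (fun _ a c => abs a <= c)) => //.
- by move=> _ a c; apply: le_trans.
- by move=> _ a c d; apply: le_trans.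
- by move=> _; rewrite abs0.
- by move=> _; rewrite abs1.
- by move=> _ a c; rewrite absN.
- by move=> _ a b c d ac bd; apply: le_trans (absD _ _) (lerD ac bd).
- by move=> _ a b c d ac bd; rewrite absM ler_pM.
- by move=> Q Q' QQ' /QQ'.
- by move=> Q Qtt; exists tt.
Defined.

(** An ideal is zero, with the empty family of generators, or contains some [f != 0]; the quotient a
    / f is then bounded with constant [abs f^-1]. *)
Lemma strongly_noetherian_field : strongly_noetherian field_gauge.
Proof.
move=> I II; have [[f If f0]|I0] := pselect (exists2 f, I f & f != 0).
  exists unit, (fun=> f); split=> //; exists (abs f^-1) => //= a c Ia ac.
  exists (fun=> a / f) => [_|]; first by rewrite /= absM mulrC ler_wpM2l.
  by rewrite big_const card_unit /= addr0 divfK.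
exists void, (of_void _); split=> [[]|].
exists 0 => //= a c Ia _; exists (of_void _) => [[]|].
rewrite big1 => [|[]//]; apply/eqP; apply: contraT => a0.
by case: I0; exists a.
Qed.

End ValuedField.

Section Tower.
Variables (R : realFieldType) (K : fieldType) (g : gauge R K).
Hypothesis sn : strongly_noetherian g.

Fixpoint power_series (n : nat) : comNzRingType :=
  if n is m.+1 then pseries (power_series m) else K.

Fixpoint power_series_gauge (n : nat) : gauge R (power_series n) :=
  match n return gauge R (power_series n) with
  | 0 => g
  | m.+1 => ps_gauge (power_series_gauge m)
  end.

Lemma power_series_strongly_noetherian n : strongly_noetherian (power_series_gauge n).
Proof. by elim: n => // n; exact: strongly_noetherian_pseries. Qed.

End Tower.

(** * Complex power series *)

Section ComplexAbs.
Local Open Scope classical_set_scope.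
Variable R : realType.
Local Notation C := (Cplx R).

Definition cplx_real : {rmorphism R -> C} := sval (cid (Cplx_real R)).

Lemma cplx_real_le : {mono cplx_real : a b / a <= b}.
Proof. by have [] := svalP (cid (Cplx_real R)). Qed.

Lemma cplx_real_lt : {mono cplx_real : a b / a < b}.
Proof. by have [] := svalP (cid (Cplx_real R)). Qed.

Lemma cplx_real_ge0 (z : C) : 0 <= z -> exists a, z = cplx_real a.
Proof. by have [_ _] := svalP (cid (Cplx_real R)); apply. Qed.

Lemma cplx_real_norm a : `|cplx_real a| = cplx_real `|a|.
Proof.
have [a0|/ltW a0] := leP 0 a.
  by rewrite !ger0_norm // -(rmorph0 cplx_real) cplx_real_le.
by rewrite !ler0_norm ?rmorphN // -(rmorph0 cplx_real) cplx_real_le.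
Qed.

(** The norm of [C] takes values in [C], whereas gauges are measured in the ordered field [R]. *)
Definition cabs (z : C) : R := sval (cid (cplx_real_ge0 (normr_ge0 z))).

Lemma cabsE z : cplx_real (cabs z) = `|z|.
Proof. exact/esym/(svalP (cid (cplx_real_ge0 (normr_ge0 z)))). Qed.

Let real_inj : injective cplx_real.
Proof. exact: fmorph_inj. Qed.

Lemma cabs_ge0 z : 0 <= cabs z.
Proof. by rewrite -cplx_real_le cabsE rmorph0. Qed.

Lemma cabs0 : cabs 0 = 0.
Proof. by apply: real_inj; rewrite cabsE normr0 rmorph0. Qed.

Lemma cabs1 : cabs 1 = 1.
Proof. by apply: real_inj; rewrite cabsE normr1 rmorph1. Qed.

Lemma cabsN z : cabs (- z) = cabs z.
Proof. by apply: real_inj; rewrite !cabsE normrN. Qed.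

Lemma cabsD y z : cabs (y + z) <= cabs y + cabs z.
Proof. by rewrite -cplx_real_le rmorphD !cabsE ler_normD. Qed.

Lemma cabsM y z : cabs (y * z) = cabs y * cabs z.
Proof. by apply: real_inj; rewrite rmorphM !cabsE normrM. Qed.

Definition cplx_gauge : gauge R C :=
  field_gauge cabs_ge0 cabs0 cabs1 cabsN cabsD cabsM.

Lemma cvg_cplx_real (p : nat -> R) l : p N @[N --> \oo] --> l ->
  cplx_real (p N) @[N --> \oo] --> cplx_real l.
Proof.
move=> pl; apply/cvgrPdist_lt => e e0.
have [d dE] := cplx_real_ge0 (ltW e0).
have d0 : 0 < d by rewrite -cplx_real_lt rmorph0 -dE.
move/cvgrPdist_lt: pl => /(_ d d0); apply: filterS => N.
by rewrite dE -rmorphB cplx_real_norm cplx_real_lt.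
Qed.

End ComplexAbs.

Section AbsolutelySummable.
Local Open Scope classical_set_scope.
Variables (R : realType) (n : nat).
Local Notation C := (Cplx R).
Local Notation mindex := {ffun 'I_n -> nat}.
Implicit Types u : mindex -> C.

Lemma box_sum_ge0_cvg u (M : C) : (forall m, 0 <= u m) ->
  (forall N, box_sum u N <= M) -> exists s : C, box_sum u N @[N --> \oo] --> s.
Proof.
move=> u0 uM; have b0 N : 0 <= box_sum u N by apply: sumr_ge0.
have /choice[p pE] N : exists a, box_sum u N = cplx_real R a.
  exact: cplx_real_ge0.
have [B BE] := cplx_real_ge0 (le_trans (b0 0) (uM 0)).
exists (cplx_real R (limn p)); rewrite (_ : box_sum u = cplx_real R \o p); last exact/funext.
apply: cvg_cplx_real; apply: nondecreasing_is_cvgn.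
  move=> N' N leN; rewrite -cplx_real_le -!pE !box_sumE (box_narrow _ _ leN) /=.
  by rewrite big_mkcond; apply: ler_sum => m _; case: ifP.
by exists B => _ [N _ <-]; rewrite -cplx_real_le -pE -BE.
Qed.

Lemma box_sumD u v N : box_sum (fun m => u m + v m) N = box_sum u N + box_sum v N.
Proof. exact: big_split. Qed.

Lemma box_sumZ c u N : box_sum (fun m => c * u m) N = c * box_sum u N.
Proof. by rewrite /box_sum big_distrr. Qed.

(** Absolute convergence implies convergence: real and imaginary parts become nonnegative after
    adding the norms, and bounded monotone sequences converge in [R]. The imaginary part appears as
    - Re (i z). *)
Lemma abs_sum_exists u (M : C) :
  (forall N, box_sum (fun m => `|u m|) N <= M) -> exists s, abs_sum u s.
Proof.
move=> uM.
pose pos (f : C -> C) m := `|u m| + f (u m).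
have pos_cvg (f : C -> C) : (forall z, f z \is Num.real) -> (forall z, `|f z| <= `|z|) ->
    exists s : C, box_sum (f \o u) N @[N --> \oo] --> s.
  move=> freal fle.
  have [m|N|s1 s1E] := @box_sum_ge0_cvg (pos f) (M + M).
  - by rewrite /pos -lerBlDr sub0r; apply: le_trans (fle _); rewrite -normrN real_ler_norm ?rpredN.
  - rewrite box_sumD lerD //; apply: le_trans (uM N); apply: ler_sum => m _.
    by apply: le_trans (fle _); rewrite real_ler_norm.
  have [//|s2 s2E] := @box_sum_ge0_cvg (fun m => `|u m|) M _ uM.
  exists (s1 - s2).
  rewrite (_ : box_sum _ = (fun N => box_sum (pos f) N - box_sum (fun m => `|u m|) N)).
    exact: cvgB.
  by apply/funext => N; rewrite box_sumD addrC addKr.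
have Re_le (z : C) : `|'Re z| <= `|z| by rewrite (leif_normC_Re_Creal z).
have [|//|s1 s1E] := pos_cvg (fun z => 'Re z); first exact: Creal_Re.
have [||s2 s2E] := pos_cvg (fun z => 'Re ('i * z)).
- by move=> z; apply: Creal_Re.
- by move=> z; apply: le_trans (Re_le _) _; rewrite normrM normCi mul1r.
exists (s1 + (- 'i) * s2); split; first by exists M.
rewrite (_ : box_sum u = (fun N => box_sum (fun m => 'Re (u m)) N +
    (- 'i) * box_sum (fun m => 'Re ('i * u m)) N)).
  by apply: cvgD s1E _; apply: cvgM s2E; apply: cvg_cst.
apply/funext => N; rewrite -box_sumZ -box_sumD; congr box_sum; apply/funext => m.
by rewrite ReMil mulrNN -Crect.
Qed.

Lemma abs_sum_unique u (s t : C) : abs_sum u s -> abs_sum u t -> s = t.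
Proof. by move=> [_ us] [_ ut]; apply: (cvg_unique (@norm_hausdorff _ C)) us ut. Qed.

End AbsolutelySummable.

(** * Iterated power series as multiple series *)

Section Coefficients.
Local Open Scope classical_set_scope.
Variable R : realType.
Local Notation C := (Cplx R).
Local Notation mindex n := {ffun 'I_n -> nat}.
Local Notation PS := (power_series C).
Local Notation G := (power_series_gauge (cplx_gauge R)).

Definition mtail n (m : mindex n.+1) : mindex n := [ffun i => m (lift ord0 i)].
Definition mcons n k (m : mindex n) : mindex n.+1 :=
  [ffun i => if unlift ord0 i is Some j then m j else k].

Lemma mcons0 n k (m : mindex n) : mcons k m ord0 = k.
Proof. by rewrite ffunE unlift_none. Qed.

Lemma mconsK n k (m : mindex n) : mtail (mcons k m) = m.
Proof. by apply/ffunP => i; rewrite !ffunE liftK. Qed.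

Lemma mtailK n (m : mindex n.+1) : mcons (m ord0) (mtail m) = m.
Proof. by apply/ffunP => i; rewrite !ffunE; case: unliftP => [j|] ->; rewrite ?ffunE. Qed.

(** Index 0 belongs to the outermost variable, the one adjoined last. *)
Fixpoint mcoef n : PS n -> mindex n -> C :=
  match n return PS n -> mindex n -> C with
  | 0 => fun a _ => a
  | n'.+1 => fun a m => mcoef (a (m ord0)) (mtail m)
  end.

Fixpoint of_coef n : (mindex n -> C) -> PS n :=
  match n return (mindex n -> C) -> PS n with
  | 0 => fun c => c [ffun i => 0%N]
  | n'.+1 => fun c k => of_coef (fun m => c (mcons k m))
  end.

Lemma of_coefK n (c : mindex n -> C) m : mcoef (of_coef c) m = c m.
Proof.
elim: n c m => [|n IHn] c m /=; last by rewrite IHn mtailK.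
by congr c; apply/ffunP => -[].
Qed.

Lemma mcoefB n (a b : PS n) m : mcoef (a - b) m = mcoef a m - mcoef b m.
Proof. by elim: n a b m => //= n IHn a b m; rewrite -IHn. Qed.

Lemma mcoefD n (a b : PS n) m : mcoef (a + b) m = mcoef a m + mcoef b m.
Proof. by elim: n a b m => //= n IHn a b m; rewrite -IHn. Qed.

Lemma mcoef0 n (m : mindex n) : mcoef (0 : PS n) m = 0.
Proof. by rewrite -(subrr (0 : PS n)) mcoefB subrr. Qed.

Lemma mcoef1 n (m : mindex n) : mcoef (1 : PS n) m = [forall i, m i == 0%N]%:R.
Proof.
elim: n m => [|n IHn] m /=.
  by rewrite (_ : [forall i, _]) //; apply/forallP => -[].
have [m0|m0] := eqVneq (m ord0) 0%N.
  rewrite (_ : (1 : PS n.+1) (m ord0) = 1) ?IHn; last by rewrite m0.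
  congr (nat_of_bool _)%:R; apply/forallP/forallP => mE i; last by rewrite ffunE.
  by case: (unliftP ord0 i) => [j|] ->; rewrite ?m0 //; have := mE j; rewrite ffunE.
rewrite (_ : (1 : PS n.+1) (m ord0) = 0) ?mcoef0; last first.
  by case: (m ord0) m0.
by case: forallP => // /(_ ord0); rewrite (negPf m0).
Qed.

Lemma sum_ffun_cons n N (V : nmodType) (F : {ffun 'I_n.+1 -> 'I_N} -> V) :
  \sum_f F f = \sum_(j < N) \sum_(f : {ffun 'I_n -> 'I_N})
    F [ffun i => if unlift ord0 i is Some i' then f i' else j].
Proof.
rewrite pair_big (reindex (fun p : 'I_N * {ffun 'I_n -> 'I_N} =>
  [ffun i => if unlift ord0 i is Some i' then p.2 i' else p.1])) //=.
exists (fun f : {ffun 'I_n.+1 -> 'I_N} => (f ord0, [ffun i => f (lift ord0 i)])) => [[j f]|f] _.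
  congr pair; first by rewrite ffunE unlift_none.
  by apply/ffunP => i; rewrite !ffunE liftK.
by apply/ffunP => i; rewrite !ffunE; case: unliftP => [i'|] ->; rewrite ?ffunE.
Qed.

Lemma big_box_cons n N (P : pred (mindex n.+1)) (F : mindex n.+1 -> C) :
  \sum_(k <- Defs.box n.+1 N | P k) F k =
  \sum_(j < N) \sum_(k <- Defs.box n N | P (mcons j k)) F (mcons j k).
Proof.
rewrite big_image_cond big_mkcond sum_ffun_cons; apply: eq_bigr => j _.
rewrite big_image_cond [RHS]big_mkcond; apply: eq_bigr => f _.
rewrite (_ : [ffun i => _] = mcons j [ffun i => f i : nat]) //.
by apply/ffunP => i; rewrite !ffunE; case: unliftP => [i'|] _; rewrite ?ffunE.
Qed.

Lemma mcoefM n (a b : PS n) m : mcoef (a * b) m = Defs.conv (mcoef a) (mcoef b) m.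
Proof.
elim: n a b m => [|n IHn] a b m.
  have m0 : m \in Defs.box 0 1 by rewrite Defs.mem_box; apply/forallP => -[].
  rewrite (Defs.convE _ _ m0) big_image_cond /= (big_pred1 [ffun=> ord0]) //.
  move=> f; transitivity true; first by apply/forallP => -[].
  by apply/esym/eqP/ffunP => -[].
pose N := (\sum_i m i)%N.+1.
have mN : m \in Defs.box n.+1 N.
  by rewrite Defs.mem_box; apply/forallP => i; rewrite ltnS (bigD1 i) //= leq_addr.
have tN : mtail m \in Defs.box n N.
  rewrite Defs.mem_box; apply/forallP => i; rewrite ffunE.
  by move: mN; rewrite Defs.mem_box => /forallP.
rewrite (Defs.convE _ _ mN) big_box_cons.
have m0N : (m ord0 < N)%N by move: mN; rewrite Defs.mem_box => /forallP.
rewrite (_ : mcoef (a * b) m = \sum_(j < (m ord0).+1)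
    mcoef (a j * b (m ord0 - j)%N) (mtail m)); last first.
  rewrite /= (pseriesM a b).
  apply: (big_morph (fun x : PS n => mcoef x (mtail m))); last exact: mcoef0.
  by move=> x y; exact: mcoefD.
rewrite (big_ord_widen_cond N (fun=> true) (fun j => mcoef (a j * b (m ord0 - j)%N) (mtail m))) //.
rewrite big_mkcond; apply: eq_bigr => j _ /=; rewrite ltnS.
have lemE k : Defs.lem (mcons j k) m = (j <= m ord0)%N && Defs.lem k (mtail m).
  apply/forallP/andP => [km|[jm /forallP km] i].
    split; first by have := km ord0; rewrite mcons0.
    by apply/forallP => i; have := km (lift ord0 i); rewrite !ffunE liftK.
  rewrite ffunE; case: unliftP => [i'|] -> //.
  by have := km i'; rewrite ffunE.
under eq_bigl do rewrite lemE.
case: ifP => jm /=; last by rewrite big_pred0.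
rewrite IHn (Defs.convE _ _ tN); apply: eq_bigr => k _.
rewrite /= mcons0 mconsK; congr (_ * mcoef (b _) _); first by rewrite ffunE mcons0.
by apply/ffunP => i; rewrite !ffunE liftK.
Qed.

End Coefficients.

(** * Local rings of germs *)

Section Expansion.
Local Open Scope classical_set_scope.
Variable R : realType.
Local Notation C := (Cplx R).
Local Notation mindex n := {ffun 'I_n -> nat}.
Local Notation PS := (power_series C).
Local Notation G := (power_series_gauge (cplx_gauge R)).
Local Notation iota := (cplx_real R).

Definition degree n (m : mindex n) := (\sum_i m i)%N.

Lemma degree_mcons n k (m : mindex n) : degree (mcons k m) = (k + degree m)%N.
Proof.
rewrite /degree big_ord_recl mcons0; congr addn; apply: eq_bigr => i _.
by rewrite ffunE liftK.
Qed.

Lemma degree0 (m : mindex 0) : degree m = 0%N.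
Proof. by rewrite /degree big_ord0. Qed.

Lemma half_geometric N : \sum_(k < N) 2^-1 ^+ k <= 2 :> R.
Proof.
suff -> : \sum_(k < N) 2^-1 ^+ k = 2 - 2 * 2^-1 ^+ N :> R.
  by rewrite gerBl mulr_ge0 ?exprn_ge0.
elim: N => [|N IHN]; first by rewrite big_ord0 expr0 mulr1 subrr.
by rewrite big_ord_recr /= IHN exprS; field.
Qed.

(** A Cauchy estimate, with t the minimum of 1 and all radii. *)
Lemma nb_coef n (rho : polyradius (G n)) : exists t : {posnum R},
  forall a c, nb (G n) rho a c -> forall m, cabs (mcoef a m) * t%:num ^+ degree m <= c.
Proof.
elim: n rho => [|n IHn] rho.
  by exists (PosNum ltr01) => a c ac m; rewrite degree0 mulr1.
have [t tP] := IHn rho.1.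
have s0 : 0 < Num.min t%:num rho.2%:num by rewrite lt_min !gt0.
exists (PosNum s0) => a c [u au uc] m /=; set s := Num.min _ _ in s0 *.
have s1 : s <= t%:num by rewrite ge_min lexx.
have s2 : s <= rho.2%:num by rewrite ge_min lexx orbT.
have s0' := ltW s0.
apply: le_trans (uc (m ord0).+1); rewrite big_ord_recr /= ler_wpDl //.
  by apply: sumr_ge0 => k _; rewrite mulr_ge0 ?(nb_ge0 (au k)) ?exprn_ge0.
rewrite -[X in degree X](mtailK m) degree_mcons exprD mulrCA mulrC.
apply: ler_pM; rewrite ?mulr_ge0 ?cabs_ge0 ?exprn_ge0 //; last first.
  by rewrite lerXn2r ?nnegrE.
apply: le_trans (tP _ _ (au (m ord0)) (mtail m)).
by rewrite ler_wpM2l ?cabs_ge0 // lerXn2r ?nnegrE.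
Qed.

(** On half the radius every variable contributes a geometric series of ratio 1/2, hence a factor 2.
    With [nb_coef], this identifies convergence in the gauge with convergence of the multiple
    series. *)
Lemma coef_nb n (t : {posnum R}) : exists rho : polyradius (G n),
  forall a M, (forall m, cabs (mcoef a m) * t%:num ^+ degree m <= M) ->
  nb (G n) rho a (M * 2 ^+ n).
Proof.
elim: n => [|n [rho rhoP]].
  exists tt => a M aM /=; have := aM [ffun=> 0%N].
  by rewrite degree0 !mulr1.
have t0 : 0 < t%:num / 2 by rewrite divr_gt0.
exists (rho, PosNum t0) => a M aM.
have M0 : 0 <= M.
  by apply: le_trans (aM [ffun=> 0%N]); rewrite mulr_ge0 ?cabs_ge0 ?exprn_ge0.
exists (fun k => M / t%:num ^+ k * 2 ^+ n) => [k|N] /=.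
  apply: rhoP => m; have := aM (mcons k m).
  by rewrite degree_mcons exprD /= mcons0 mconsK mulrCA mulrC -ler_pdivlMr ?exprn_gt0.
apply: le_trans (_ : _ <= M * 2 ^+ n * \sum_(k < N) 2^-1 ^+ k) _; last first.
  by rewrite exprSr mulrA ler_wpM2l ?mulr_ge0 ?exprn_ge0 // half_geometric.
rewrite big_distrr /=; apply: ler_sum => k _.
rewrite le_eqVlt; apply/orP; left; apply/eqP; rewrite expr_div_n exprVn.
have : t%:num ^+ k != 0 by rewrite gt_eqF ?exprn_gt0.
have : 2 ^+ k != 0 :> R by rewrite gt_eqF ?exprn_gt0.
move: (2 ^+ k) (t%:num ^+ k) => x y x0 y0.
by field; rewrite x0 y0.
Qed.

Variables (n : nat) (x : 'rV[C]_n).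
Implicit Types (f h : holo x) (a b : PS n).

Definition expands a f : Prop :=
  \forall z \near x, abs_sum (fun m => mcoef a m * monom (z - x) m) (f z).

(** At such a point every monomial is the power of t given by its degree. *)
Lemma near_diagonal (P : 'rV[C]_n -> Prop) : (\forall z \near x, P z) ->
  exists t : {posnum R}, P (x + const_mx (iota t%:num)).
Proof.
move=> /nbhs_ballP[e /= e0 eP]; have [d dE] := cplx_real_ge0 (ltW e0).
have d0 : 0 < d / 2 by rewrite divr_gt0 // -cplx_real_lt rmorph0 -dE.
exists (PosNum d0); apply: eP; split=> // i j.
rewrite -ball_normE /= !mxE opprD addrA subrr sub0r normrN cplx_real_norm.
by rewrite dE cplx_real_lt gtr0_norm // gtr_pMr ?invf_lt1 ?ltr1n // -cplx_real_lt rmorph0 -dE.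
Qed.

(** Absolute convergence at one diagonal point bounds all terms there, which is the hypothesis of
    [coef_nb]. *)
Lemma holo_expands f : exists2 a, convergent (G n) a & expands a f.
Proof.
have [c cf] : holomorphic_at x f by apply/asboolP; have := valP f.
exists (of_coef c); last first.
  apply: filterS cf => z; congr abs_sum; apply/funext => m.
  by rewrite of_coefK.
have [t [[M0 M0P] _]] := near_diagonal cf.
have M00 : 0 <= M0 by apply: le_trans (M0P 0%N); apply: sumr_ge0.
have [M ME] := cplx_real_ge0 M00.
have [rho rhoP] := coef_nb n t.
apply: convergentW (rhoP (of_coef c) M _) => m.
rewrite of_coefK -cplx_real_le -ME; apply: le_trans (M0P (degree m).+1).
have mN : m \in Defs.box n (degree m).+1.
  by rewrite Defs.mem_box; apply/forallP => i; rewrite ltnS /degree (bigD1 i) //= leq_addr.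
rewrite box_sumE (bigD1_seq m) ?Defs.box_uniq //= ler_wpDr ?sumr_ge0 //.
rewrite normrM rmorphM cabsE ler_wpM2l // /monom addrC addKr.
rewrite (eq_bigr (fun i => iota t%:num ^+ m i)) => [|i _]; last by rewrite mxE.
by rewrite prodrXr normrX cplx_real_norm ger0_norm // rmorphXn.
Qed.

(** Abel's lemma: within distance t / 2 of the centre the terms are at most c 2^(- degree), and
    their sums over boxes factor into n geometric sums. *)
Lemma convergent_abs_sum a : convergent (G n) a -> \forall z \near x,
  exists s, abs_sum (fun m => mcoef a m * monom (z - x) m) s.
Proof.
move=> /small_ex[rho [c ac]]; have [t tP] := nb_coef rho.
have d0 : 0 < iota (t%:num / 2) by rewrite -(rmorph0 iota) cplx_real_lt divr_gt0.
have c0 := nb_ge0 ac.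
apply/nbhs_ballP; exists (iota (t%:num / 2)) => //= z [_ zP].
have zi i : `|(z - x) 0 i| <= iota (t%:num / 2).
  by apply: ltW; have := zP 0 i; rewrite -ball_normE /= distrC !mxE.
apply: (@abs_sum_exists _ _ _ (iota (c * 2 ^+ n))) => N.
apply: le_trans (_ : _ <= iota (\sum_(m : {ffun 'I_n -> 'I_N}) c * \prod_i 2^-1 ^+ m i)) _.
  rewrite rmorph_sum; apply: ler_sum => m _; set m' := [ffun i => _].
  rewrite normrM -cabsE.
  apply: le_trans (_ : _ <= iota (cabs (mcoef a m')) * iota (t%:num / 2) ^+ degree m') _.
    rewrite ler_wpM2l ?cabsE // /monom normr_prod -prodrXr.
    by apply: ler_prod => i _; rewrite normr_ge0 normrX lerXn2r ?nnegrE // ltW.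
  rewrite -rmorphXn -rmorphM cplx_real_le expr_div_n mulrA /= -exprVn.
  rewrite (_ : \prod_i _ = 2^-1 ^+ degree m') ?ler_wpM2r ?exprn_ge0 //; last first.
    by rewrite -prodrXr; apply: eq_bigr => i _; rewrite ffunE.
  exact: tP ac m'.
rewrite cplx_real_le -big_distrr ler_wpM2l //=.
rewrite -(bigA_distr_bigA (fun _ (k : 'I_N) => 2^-1 ^+ k)) /=.
rewrite prodr_const card_ord lerXn2r ?nnegrE ?half_geometric //.
by apply: sumr_ge0 => k _; rewrite exprn_ge0.
Qed.

Lemma convergent_expands a : convergent (G n) a -> exists f, expands a f.
Proof.
move=> /convergent_abs_sum ca.
(* [holo] consists of functions on the whole space; where the series does not converge the value is
   set to 0. *)
have /choice[s sE] z : exists s, (exists s', abs_sum (fun m => mcoef a m * monom (z - x) m) s') ->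
    abs_sum (fun m => mcoef a m * monom (z - x) m) s.
  by have [[s' s'E]|ns] := pselect (exists s', abs_sum (fun m => mcoef a m * monom (z - x) m) s');
    [exists s' | exists 0].
have sx : \forall z \near x, abs_sum (fun m => mcoef a m * monom (z - x) m) (s z).
  by apply: filterS ca => z; exact: sE.
have sh : s \in in_holo x by apply/asboolP; exists (mcoef a).
by exists (Holo sh).
Qed.

Lemma expands_unique a f h : expands a f -> expands a h ->
  \forall z \near x, f z = h z.
Proof. by move=> af ah; apply: filterS2 af ah => z; exact: abs_sum_unique. Qed.

Lemma expandsB a b f h : expands a f -> expands b h -> expands (a - b) (f - h).
Proof.
move=> af bh; apply: filterS2 af bh => z az bz.
rewrite (_ : (fun m => _) = fun m => mcoef a m * monom (z - x) m - mcoef b m * monom (z - x) m).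
  exact: abs_sumB.
by apply/funext => m; rewrite mcoefB mulrBl.
Qed.

Lemma expandsM a b f h : expands a f -> expands b h -> expands (a * b) (f * h).
Proof.
move=> af bh; apply: filterS2 af bh => z az bz.
rewrite (_ : (fun m => _) = Defs.conv (fun m => mcoef a m * monom (z - x) m)
    (fun m => mcoef b m * monom (z - x) m)).
  exact: abs_sumM.
apply/funext => m; rewrite mcoefM /Defs.conv big_distrl /=; apply: eq_bigr => k /forallP km.
rewrite mulrACA /monom -big_split /=; congr (_ * _); apply: eq_bigr => i _.
by rewrite -exprD ffunE subnKC.
Qed.

Lemma expands1 : expands 1 1.
Proof.
apply: filterE => z; apply: abs_sum1 => m; rewrite mcoef1.
case: forallP => [m0|_]; last by rewrite mul0r.
by rewrite /monom big1 ?mulr1 // => i _; rewrite (eqP (m0 i)) expr0.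
Qed.

Lemma expands0 : expands 0 0.
Proof. by have := expandsB expands1 expands1; rewrite !subrr. Qed.

Lemma expandsD a b f h : expands a f -> expands b h -> expands (a + b) (f + h).
Proof.
move=> af bh; rewrite -[b]opprK -[h]opprK; apply: expandsB => //.
by rewrite -sub0r -[- h]sub0r; apply: expandsB bh; exact: expands0.
Qed.

Lemma expands_sum I (r : seq I) (P : pred I) (F : I -> PS n) (H : I -> holo x) :
  (forall i, P i -> expands (F i) (H i)) ->
  expands (\sum_(i <- r | P i) F i) (\sum_(i <- r | P i) H i).
Proof.
move=> FH; elim/big_ind2: _ => //; first exact: expands0.
by move=> a f b h af bh; exact: expandsD.
Qed.

Lemma expands_center a f : expands a f -> f x = mcoef a [ffun=> 0%N].
Proof.
move=> /nbhs_singleton fx; apply: abs_sum_unique fx _.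
pose u (m : mindex n) : C := mcoef a [ffun=> 0%N] * [forall i : 'I_n, m i == 0%N]%:R.
rewrite (_ : (fun m => _) = u); last first.
  apply/funext => m; rewrite /u subrr; case: forallP => [m0|/forallP m0].
    rewrite (_ : m = [ffun=> 0%N]); last by apply/ffunP => i; rewrite ffunE (eqP (m0 i)).
    by rewrite /monom big1 // => i _; rewrite ffunE expr0.
  move: m0; rewrite negb_forall => /existsP[i mi].
  by rewrite /monom (bigD1 i) //= mxE expr0n (negPf mi) mul0r !mulr0.
have [[M dM] d1] : abs_sum (fun m : mindex n => [forall i : 'I_n, m i == 0%N]%:R : C) 1.
  exact: abs_sum1.
split.
  exists (`|mcoef a [ffun=> 0%N]| * M) => N.
  rewrite (_ : (fun m => _) = fun m : mindex n => `|mcoef a [ffun=> 0%N]| * `|[forall i : 'I_n, m i == 0%N]%:R|).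
    by rewrite box_sumZ ler_wpM2l.
  by apply/funext => m; rewrite /u normrM.
rewrite (_ : box_sum u = fun N => mcoef a [ffun=> 0%N] *
  box_sum (fun m : mindex n => [forall i : 'I_n, m i == 0%N]%:R) N).
  by rewrite -[X in _ --> X]mulr1; apply: cvgM d1; exact: cvg_cst.
by apply/funext => N; rewrite /u box_sumZ.
Qed.

End Expansion.

Section PowerSeriesInverse.
Variable R : realType.
Local Notation PS := (power_series (Cplx R)).
Local Notation G := (power_series_gauge (cplx_gauge R)).

Lemma power_series_inv n (a : PS n) : convergent (G n) a ->
  mcoef a [ffun=> 0%N] != 0 -> exists2 b, convergent (G n) b & b * a = 1.
Proof.
elim: n a => [|n IHn] a ca a0.
  by exists a^-1; [exists (cabs a^-1) => /= | rewrite mulVf].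
have [||b cb ba] := IHn (a 0%N); first exact: ps_convergent_coef.
  move: a0; rewrite /= ffunE; congr (mcoef _ _ != 0).
  by apply/ffunP => i; rewrite !ffunE.
by have [h ch ha] := ps_convergent_inv ca cb ba; exists h.
Qed.

End PowerSeriesInverse.

Section LocalRingNoetherian.
Variables (R : realType) (n : nat) (X : germ R n).
Local Notation G := (power_series_gauge (cplx_gauge R)).

(** The residue is the constant coefficient of an expansion, so the expansion has a convergent
    inverse. *)
Lemma local_ring_unit (a : local_ring X) : residue a != 0 -> exists b, b * a = 1.
Proof.
rewrite -[a]germ_of_repr residue_germ_of; set f := repr a => f0.
have [c cc cf] := holo_expands f; rewrite (expands_center cf) in f0.
have [d cd dc] := power_series_inv cc f0.
have [h dh] := convergent_expands (gpt X) cd.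
exists (germ_of h); rewrite -germ_ofM -germ_of1; apply/eqP/germ_ofP.
have := expandsM dh cf; rewrite dc => /(expands_unique (expands1 _)).
by apply: filterS => z -> _.
Qed.

Lemma local_ring_noetherian : noetherian (local_ring X)^o.
Proof.
move=> N [N0 Nlin].
(* The preimage of [N] in the convergent power series. Generators with convergent quotients there
   give generators of [N]. *)
pose I (a : power_series (Cplx R) n) := convergent (G n) a /\
  exists2 f : holo (gpt X), expands a f & N (germ_of f).
have II : convergent_ideal (G n) I.
  split.
  - by move=> a [].
  - split; last first.
      exists 0; first exact: expands0.
      by rewrite -(subrr 1) germ_ofB subrr.
    by rewrite -(subrr 1); apply: convergentB; exact: convergent1.
  - move=> a b [ca [f af Nf]] [cb [h bh Nh]]; split.
      by apply: smallW (smallI ca cb) => r [[c ac] [d bd]]; exists (c + d); apply: nbD.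
    exists (f + h); first exact: expandsD.
    rewrite (_ : germ_of (f + h) = 1 *: (germ_of f : (local_ring X)^o) + germ_of h).
      exact: Nlin.
    by rewrite scale1r; exact: rmorphD.
  move=> c a cc [ca [f af Nf]]; split; first exact: convergentM.
  have [h ch] := convergent_expands (gpt X) cc.
  exists (h * f); first exact: expandsM.
  rewrite (_ : germ_of (h * f) = germ_of h *: (germ_of f : (local_ring X)^o) + 0).
    exact: Nlin.
  by rewrite addr0; exact: rmorphM.
have snC : strongly_noetherian (cplx_gauge R) by exact: strongly_noetherian_field.
have sn := power_series_strongly_noetherian snC (n := n).
have [J [g [Ig gP]]] := strongly_noetherian_fg sn II.
have /choice[F FE] j : exists f : holo (gpt X), expands (g j) f /\ N (germ_of f).
  by have [_ [f gf Nf]] := Ig j; exists f.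
exists #|J|, (fun i => germ_of (F (enum_val i))) => x; split=> [Nx|[c ->]]; last first.
  by apply: submodule_sum => // i; have [] := FE (enum_val i).
have [a ca ax] := holo_expands (repr x : holo (gpt X)).
have Ia : I a by split=> //; exists (repr x); rewrite ?germ_of_repr.
have [h hc aE] := gP a Ia.
have /choice[H HE] j := convergent_expands (gpt X) (hc j).
exists (\row_i germ_of (H (enum_val i))).
have : expands a (\sum_j H j * F j).
  by rewrite aE; apply: expands_sum => j _; apply: expandsM => //; have [] := FE j.
move=> /(expands_unique ax) xE.
have -> : x = germ_of (\sum_j H j * F j).
  rewrite -[LHS]germ_of_repr; apply/eqP/germ_ofP.
  by apply: filterS xE => z -> _.
rewrite (_ : germ_of _ = \sum_j germ_of (H j) * germ_of (F j)); last first.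
  have gD f k : germ_of (f + k) = germ_of f + germ_of k :> local_ring X by exact: rmorphD.
  have g0 : germ_of 0 = 0 :> local_ring X by exact: rmorph0.
  rewrite (big_morph (@germ_of R n X) gD g0).
  by apply: eq_bigr => j _; exact: rmorphM.
rewrite (reindex (@enum_val J predT)) /=; last exact/onW_bij/enum_val_bij.
by apply: eq_bigr => i _; rewrite mxE.
Qed.

End LocalRingNoetherian.

(** * Gluing *)

Section Cyclic.
Variables (R : comNzRingType) (k : fieldType) (eps : {rmorphism R -> k}).
Hypothesis loc : forall a, eps a != 0 -> exists b, b * a = 1.
Hypothesis noe : noetherian R^o.

Lemma betti_cyclic (K M : lmodType R) (j : {linear K -> R^o}) (h : {linear R^o -> M}) :
  injective j -> (forall x, exists u, h u = x) ->
  (forall u, h u = 0 <-> exists x, u = j x) ->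
  (forall x, eps (j x) = 0) -> fg_module K ->
  betti eps M 0 = 1%N /\ forall i, betti eps M i.+1 = betti eps K i.
Proof.
move=> j_inj h_surj hj j_eps fgK.
have lj : linear (fun x : K => const_mx (j x) : 'rV[R]_1).
  by move=> a u v; apply/rowP => i; rewrite linearP !mxE.
have lh : linear (fun u : 'rV[R]_1 => h (u 0 0)).
  by move=> a u v; rewrite !mxE linearP.
apply: (betti_syzygy loc noe (j := to_linear lj) (h := to_linear lh)) => //=.
- by move=> x y /rowP/(_ 0); rewrite !mxE => /j_inj.
- by move=> x; have [u <-] := h_surj x; exists (const_mx u); rewrite mxE.
- move=> u; rewrite hj; split=> -[x xE]; exists x.
    by apply/rowP => i; rewrite ord1 xE mxE.
  by rewrite xE mxE.
by move=> x; apply/rowP => i; rewrite !mxE j_eps.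
Qed.

(** Nakayama's lemma, read off a minimal resolution. *)
Lemma betti0_eq0 (M : lmodType R) :
  fg_module M -> betti eps M 0 = 0%N -> forall x : M, x = 0.
Proof.
move=> /(minimal_resolution loc noe)[F Fm]; rewrite (betti_minimal _ Fm) => F0 x.
have [u <-] := faug_surj F x; rewrite (_ : u = 0) ?linear0 //.
by apply/rowP => i; have := leq_trans (ltn_ord i) (eq_leq F0).
Qed.

Lemma ker_mod_fg (S : comNzRingType) (phi : {rmorphism R -> S}) :
  fg_module (ker_mod phi).
Proof.
have [|p [v vE]] := noe (N := fun a => phi a = 0).
  by split=> [|a u w u0 w0]; rewrite ?rmorph0 // rmorphD rmorphM u0 w0 mulr0 addr0.
have v0 j : v j \in in_ker phi by rewrite inE; apply/eqP/(generates_mem j vE).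
exists p, (fun j => KerMod (v0 j)) => x; split=> // _.
have /vE[c cE] : phi (val x) = 0 by apply/eqP; exact: (valP x).
by exists c; apply: val_inj; rewrite cE raddf_sum.
Qed.

End Cyclic.

Section Shift.
Variable F : fieldType.

Definition fps_X : fps F := fun n => (n == 1)%:R.

Lemma fps_X_mul0 (a : fps F) : (fps_X * a) 0 = 0.
Proof. by rewrite [LHS]big_ord1 mul0r. Qed.

Lemma fps_X_mulS (a : fps F) n : (fps_X * a) n.+1 = a n.
Proof.
rewrite [LHS]big_ord_recl mul0r add0r big_ord_recl mul1r subn1 big1 ?addr0 // => j _.
by rewrite mul0r.
Qed.

Lemma fps_X_eq0 : fps_X != 0.
Proof. by apply/eqP => /(congr1 (@^~ 1%N))/eqP; rewrite oner_eq0. Qed.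

End Shift.

(** * Fiber products of local rings *)

Section Gluing.
Variables (A B D : comNzRingType) (k : fieldType).
Variables (phi : {rmorphism A -> D}) (psi : {rmorphism B -> D}).
Variables (epsA : {rmorphism A -> k}) (epsB : {rmorphism B -> k}).
Variable epsD : {rmorphism D -> k}.
Hypothesis locA : forall a, epsA a != 0 -> exists b, b * a = 1.
Hypothesis locB : forall a, epsB a != 0 -> exists b, b * a = 1.
Hypotheses (noeA : noetherian A^o) (noeB : noetherian B^o).
Hypothesis phi_surj : forall d, exists a, phi a = d.
Hypothesis psi_surj : forall d, exists b, psi b = d.
Hypothesis eps_phi : forall a, epsD (phi a) = epsA a.
Hypothesis eps_psi : forall b, epsD (psi b) = epsB b.

Local Notation V := (fiber_prod phi psi).
Local Notation pi1 := (@fiber_fst A B D phi psi : {rmorphism V -> A}).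
Local Notation pi2 := (@fiber_snd A B D phi psi : {rmorphism V -> B}).
Local Notation epsV := (epsA \o pi1 : {rmorphism V -> k}).
Local Notation K := (ker_mod phi).

Lemma fiber_prodP (u : V) : phi (pi1 u) = psi (pi2 u).
Proof. exact/eqP/(valP u). Qed.

Lemma fiber_prod_inj (u v : V) : pi1 u = pi1 v -> pi2 u = pi2 v -> u = v.
Proof.
by move=> e1 e2; apply/val_inj; rewrite [LHS]surjective_pairing [RHS]surjective_pairing; congr pair.
Qed.

Lemma fiber_prod_ex a b : phi a = psi b -> exists u : V, pi1 u = a /\ pi2 u = b.
Proof.
move=> /eqP ab; have uP : (a, b) \in in_fiber_prod phi psi by [].
by exists (FiberProd uP).
Qed.

Lemma fiber_fst_surj a : exists u : V, pi1 u = a.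
Proof.
have [b /esym bE] := psi_surj (phi a).
by have [u [ua _]] := fiber_prod_ex bE; exists u.
Qed.

Lemma fiber_snd_surj b : exists u : V, pi2 u = b.
Proof.
have [a aE] := phi_surj (psi b).
by have [u [_ ub]] := fiber_prod_ex aE; exists u.
Qed.

Lemma fiber_prod_unit (u : V) : epsV u != 0 -> exists v, v * u = 1.
Proof.
move=> u0; have [a aE] := locA u0.
have [b bE] : exists b, b * pi2 u = 1.
  by apply: locB; rewrite -eps_psi -fiber_prodP eps_phi.
have [|v [v1 v2]] := @fiber_prod_ex a b; last first.
  by exists v; apply: fiber_prod_inj; rewrite rmorphM rmorph1 ?v1 ?v2.
(* The inverses of the two components agree over [D], because inverses are unique. *)
have : psi b * psi (pi2 u) = 1 by rewrite -rmorphM bE rmorph1.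
move=> /(congr1 ( *%R (phi a))); rewrite mulr1 -fiber_prodP mulrCA -rmorphM aE.
by rewrite rmorph1 mulr1.
Qed.

(** The first projection maps onto [A], and its kernel embeds into [B] by the second. *)
Lemma fiber_prod_noetherian : noetherian V^o.
Proof.
apply: (@noetherian_extension _ V^o (restr pi1 (A^o : lmodType A)) pi1).
- by move=> a u v; rewrite rmorphD rmorphM.
- exact: noetherian_restr fiber_fst_surj noeA.
move=> N sN N1.
apply: (@noetherian_embedding _ V^o (restr pi2 (B^o : lmodType B)) pi2 N) => //.
  exact: noetherian_restr fiber_snd_surj noeB.
by move=> x y /N1 x0 /N1 y0; apply: fiber_prod_inj; rewrite x0 y0.
Qed.

Let locV := fiber_prod_unit.
Let noeV := fiber_prod_noetherian.
Let fgK : fg_module K := ker_mod_fg noeA phi.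

Let kval_linear : linear (@ker_val _ _ phi). Proof. by []. Qed.
Let kval : {linear K -> A^o} := to_linear kval_linear.

Lemma ker_eps (x : K) : epsA (kval x) = 0.
Proof. by rewrite -eps_phi (eqP (valP x : _ = true)) rmorph0. Qed.

Lemma ker_kval a : phi a = 0 <-> exists x, a = kval x.
Proof.
split=> [/eqP a0|[x ->]]; first by exists (KerMod (a0 : a \in in_ker phi)).
exact/eqP/(valP x).
Qed.

(** Stated for any model [M] of A / K, since both [D] by restriction and the quotient by the radical
    ideal K occur. *)
Lemma betti_ker_quotient (M : lmodType A) (h : {linear A^o -> M}) :
  (forall x, exists u, h u = x) -> (forall u, h u = 0 <-> phi u = 0) ->
  betti epsA M 0 = 1%N /\ forall i, betti epsA M i.+1 = betti epsA K i.
Proof.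
move=> h_surj hphi; apply: (betti_cyclic locA noeA (j := kval) (h := h)) => //.
- exact: val_inj.
- by move=> u; rewrite hphi ker_kval.
exact: ker_eps.
Qed.

Lemma betti_base_quotient : betti epsA (restr phi (D^o : lmodType D)) 0 = 1%N /\
  forall i, betti epsA (restr phi (D^o : lmodType D)) i.+1 = betti epsA K i.
Proof.
have lphi : linear (phi : A^o -> restr phi (D^o : lmodType D)).
  by move=> a u v; rewrite rmorphD rmorphM.
exact: (betti_ker_quotient (h := to_linear lphi)).
Qed.

(** The kernel of the second projection consists of the pairs (x, 0) with x in K. *)
Lemma betti_glued_snd :
  betti epsV (restr pi2 (B^o : lmodType B)) 0 = 1%N /\
  forall i, betti epsV (restr pi2 (B^o : lmodType B)) i.+1 = betti epsV (restr pi1 K) i.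
Proof.
have /choice[j jE] (x : K) : exists u : V, pi1 u = kval x /\ pi2 u = 0.
  by apply: fiber_prod_ex; rewrite rmorph0; apply/ker_kval; exists x.
have lj : linear (j : restr pi1 K -> V^o).
  move=> a u v; apply: fiber_prod_inj; rewrite rmorphD rmorphM.
    by rewrite !(jE _).1.
  by rewrite !(jE _).2 mulr0 addr0.
have lh : linear (pi2 : V^o -> restr pi2 (B^o : lmodType B)).
  by move=> a u v; rewrite rmorphD rmorphM.
apply: (betti_cyclic locV noeV (j := to_linear lj) (h := to_linear lh)) => /=.
- move=> x y /(congr1 (@fiber_fst _ _ _ phi psi)); rewrite !(jE _).1.
  exact: val_inj.
- exact: fiber_snd_surj.
- move=> u; split=> [u2|[x ->]]; last exact: (jE x).2.
  have [x xE] : exists x, pi1 u = kval x.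
    by apply/ker_kval; rewrite fiber_prodP (u2 : pi2 u = 0) rmorph0.
  by exists x; apply: fiber_prod_inj; rewrite ?(jE x).1 ?(jE x).2.
- by move=> x; rewrite (jE x).1 ker_eps.
exact: restr_fg fiber_fst_surj _ fgK.
Qed.

Lemma betti_glued_quotient (M : lmodType A) (h : {linear A^o -> M}) i :
  (forall x, exists u, h u = x) -> (forall u, h u = 0 <-> phi u = 0) ->
  (betti epsV (restr pi1 M) i.+1 <=
   betti epsV (restr pi1 (A^o : lmodType A)) i.+1 + betti epsV (restr pi1 K) i)%N.
Proof.
move=> h_surj h_ker.
have := @betti_quotient _ _ _ locV noeV _ _ _ (restr_map pi1 kval) (restr_map pi1 h) i.+1.
apply=> //=.
- exact: val_inj.
- by move=> u; rewrite h_ker ker_kval.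
- exact: restr_fg fiber_fst_surj _ fgK.
by apply: restr_fg fiber_fst_surj _ _; exact: fg_module_noetherian.
Qed.

Local Notation PVX := (poincare epsV (restr pi1 (A^o : lmodType A))).
Local Notation PVY := (poincare epsV (restr pi2 (B^o : lmodType B))).
Local Notation PVK := (poincare epsV (restr pi1 K)).
Local Notation PXZ := (poincare epsA (restr phi (D^o : lmodType D))).
Local Notation PXK := (poincare epsA K).

Lemma poincare_shift (R S : comNzRingType) (eR : {rmorphism R -> k}) (eS : {rmorphism S -> k})
    (M : lmodType R) (N : lmodType S) :
  betti eR M 0 = 1%N /\ (forall i, betti eR M i.+1 = betti eS N i) ->
  poincare eR M = 1 + fps_X rat * poincare eS N.
Proof.
move=> [b0 bS]; apply/funext => -[|i].
  rewrite [LHS](_ : _ = 1%:R); last by rewrite /poincare b0.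
  by rewrite [RHS](_ : _ = 1 + (fps_X rat * poincare eS N) 0%N) // fps_X_mul0 addr0.
rewrite [RHS](_ : _ = 0 + (fps_X rat * poincare eS N) i.+1) // fps_X_mulS add0r.
by rewrite /poincare bS.
Qed.

Hypothesis phi_ker : exists2 a, a != 0 & phi a = 0.

Lemma poincare_ker_neq0 : PXK != 0.
Proof.
have [a a0 /ker_kval[x xE]] := phi_ker.
apply/eqP => /(congr1 (@^~ 0%N))/eqP; rewrite /poincare pnatr_eq0 => /eqP.
by move=> /(betti0_eq0 locA noeA fgK)/(_ x) x0; rewrite xE x0 eqxx in a0.
Qed.

Lemma poincare_weakly_large : PVK = PXK * PVX ->
  1 - PXZ%:L != 0 /\ PVX%:L = (1 - PVY%:L) / (1 - PXZ%:L) :> laurent rat.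
Proof.
have XZ := poincare_shift betti_base_quotient.
have VY := poincare_shift betti_glued_snd.
move=> VK; have d0 : 1 - PXZ%:L != 0 :> laurent rat.
  rewrite XZ tofracD tofrac1 opprD addrA subrr sub0r oppr_eq0 tofrac_eq0.
  by rewrite mulf_neq0 ?fps_X_eq0 ?poincare_ker_neq0.
split=> //; apply: (mulIf d0); rewrite divfK // -tofrac1 -!tofracB -tofracM.
congr tofrac; rewrite XZ VY VK !opprD !addrA subrr !sub0r mulrN.
by rewrite mulrC mulrA.
Qed.

Hypothesis D_reduced : forall (d : D) n, d ^+ n = 0 -> d = 0.

Definition ker_ideal : {pred A} := [pred a | phi a == 0].

Lemma ker_ideal_closed : idealr_closed ker_ideal.
Proof.
split; first by rewrite inE rmorph0.
  by rewrite inE rmorph1 oner_eq0.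
move=> a u v; rewrite !inE => /eqP u0 /eqP v0.
by rewrite rmorphD rmorphM u0 v0 mulr0 addr0.
Qed.

(** A / K embeds into the reduced ring [D]. *)
Lemma ker_ideal_radical a n : a ^+ n \in ker_ideal -> a \in ker_ideal.
Proof. by rewrite !inE rmorphXn => /eqP/D_reduced/eqP. Qed.

Lemma large_weakly_large : large epsV epsA pi1 -> PVK = PXK * PVX.
Proof.
pose I : radical_idealr A := HB.pack ker_ideal (isIdealr.Build A ker_ideal ker_ideal_closed)
  (isRadical.Build A ker_ideal ker_ideal_radical).
move=> /(_ I); set Q := quot_mod I => lrg.
have lpi : linear (\pi_{ideal_quot I} : A^o -> Q)%qT.
  by move=> a u v; rewrite [LHS]rmorphD rmorphM.
pose h : {linear A^o -> Q} := to_linear lpi.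
have h_surj x : exists u, h u = x by exists (repr x); exact: reprK.
have h_ker u : h u = 0 <-> phi u = 0.
  rewrite (_ : (h u = 0) = (\pi_{ideal_quot I} u = \pi_{ideal_quot I} 0)%qT); last first.
    by congr (_ = _); rewrite [RHS](rmorph0 _).
  by split=> [/eqP|u0]; [|apply/eqP]; rewrite -Quotient.idealrBE subr0 inE ?u0 // => /eqP.
have XQ := poincare_shift (betti_ker_quotient h_surj h_ker).
rewrite XQ mulrDl mul1r -mulrA in lrg.
apply/funext => i; apply/eqP; rewrite eq_le.
rewrite (_ : (PXK * PVX) i = (\sum_(l < i.+1) betti epsA K l *
  betti epsV (restr pi1 (A^o : lmodType A)) (i - l))%:R); last first.
  by rewrite natr_sum; apply: eq_bigr => l _; rewrite natrM.
apply/andP; split.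
  rewrite ler_nat.
  exact: (betti_change_of_rings locV locA noeV noeA fiber_fst_surj i fgK).
(* Degree [i.+1] is compared because the factor t moves the contribution of K up by one. *)
have := congr1 (fun p : fps rat => p i.+1) lrg.
rewrite [RHS](_ : _ = PVX i.+1 + (fps_X rat * (PXK * PVX)) i.+1) // fps_X_mulS.
have := betti_glued_quotient i h_surj h_ker.
rewrite -(ler_nat rat) natrD => /[swap]; rewrite {1}/poincare => ->.
rewrite lerD2l; congr (_ <= _).
by rewrite natr_sum; apply: eq_bigr => l _; rewrite natrM.
Qed.

End Gluing.

(** * Application to germs *)

Lemma residue_pullback (R : realType) (l n : nat) (Z : germ R l) (X : germ R n)
    (alpha : germ_morphism Z X) a : residue (pullback alpha a) = residue a.
Proof.
have [f [g [-> -> /nbhs_singleton gf]]] := pullback_ex alpha a.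
by rewrite !residue_germ_of gf ?gmap_pt //; exact: gpt_in.
Qed.

Lemma local_ring_reduced (R : realType) (n : nat) (X : germ R n) (a : local_ring X) i :
  a ^+ i = 0 -> a = 0.
Proof.
rewrite -[a]germ_of_repr; set f := repr a.
have -> : germ_of f ^+ i = germ_of (f ^+ i).
  elim: i => [|i IHi]; first by rewrite !expr0 germ_of1.
  by rewrite !exprS IHi germ_ofM.
have -> : 0 = germ_of (0 : holo (gpt X)) by rewrite -(subrr (0 : holo _)) germ_ofB subrr.
move=> /eqP/germ_ofP fi; apply/eqP/germ_ofP; apply: filterS fi => z fi Xz.
have : f z ^+ i = 0 :> Cplx R.
  rewrite -[RHS](fi Xz); elim: i {fi} => // i IHi.
  by rewrite !exprS IHi.
by move=> /eqP; rewrite expf_eq0 => /andP[_ /eqP].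
Qed.

Theorem lemma3p9 (R : realType) (n m l : nat)
    (X : germ R n) (Y : germ R m) (Z : germ R l)
    (alpha : germ_morphism Z X) (beta : germ_morphism Z Y)
    (alpha_surj : forall c : local_ring Z, exists a, pullback alpha a = c)
    (beta_surj : forall c : local_ring Z, exists b, pullback beta b = c)
    (alpha_not_iso : ~ bijective (pullback alpha))
    (beta_not_iso : ~ bijective (pullback beta)) :
  (weakly_large_gluing alpha beta ->
     (P_V_X alpha beta)%:L =
       (1 - (P_V_Y alpha beta)%:L) / (1 - (P_X_Z alpha)%:L) :> laurent rat) /\
  (large_gluing alpha beta ->
     forall W : radical_idealr (local_ring X),
     (P_V_sub alpha beta W)%:L =
       (P_X_sub W)%:L * (1 - (P_V_Y alpha beta)%:L) / (1 - (P_X_Z alpha)%:L)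
       :> laurent rat).
Proof.
(* A surjection with zero kernel would be bijective; hence K is nonzero. *)
have alpha_ker : exists2 a, a != 0 & pullback alpha a = 0.
  apply: contrapT => no_ker; apply: alpha_not_iso.
  have /choice[g gK] := alpha_surj; exists g => // a; apply/eqP; rewrite -subr_eq0.
  apply: contraT => a0; case: no_ker; exists (g (pullback alpha a) - a) => //.
  by rewrite rmorphB [X in X - _]gK subrr.
pose resX : {rmorphism local_ring X -> Cplx R} := @residue R n X.
pose resY : {rmorphism local_ring Y -> Cplx R} := @residue R m Y.
pose resZ : {rmorphism local_ring Z -> Cplx R} := @residue R l Z.
have weak := @poincare_weakly_large _ _ _ _ _ _ resX resY resZ
  (@local_ring_unit _ _ X) (@local_ring_unit _ _ Y)
  (@local_ring_noetherian _ _ X) (@local_ring_noetherian _ _ Y)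
  alpha_surj beta_surj (residue_pullback alpha) (residue_pullback beta) alpha_ker.
have lrg := @large_weakly_large _ _ _ _ _ _ resX resY resZ
  (@local_ring_unit _ _ X) (@local_ring_unit _ _ Y)
  (@local_ring_noetherian _ _ X) (@local_ring_noetherian _ _ Y)
  alpha_surj beta_surj (residue_pullback alpha) (residue_pullback beta)
  (@local_ring_reduced _ _ Z).
split=> [/weak[]//|large W].
have [_ VX] := weak (lrg large).
by rewrite -mulrA -[X in _ * X]VX -tofracM; congr tofrac; exact: large W.
Qed.
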